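(* Let $N\ge 3$ and let $\varphi\in\mathcal{S}'(\mathbb{R}^N)$ be a tempered distribution. Assume that all of the following conditions hold: (a) $e^{-t|\cdot|^4}\mathcal{F}[\varphi]\in L^1(\mathbb{R}^N)$ for every $t\in(0,\infty)$; (b) $\mathcal{F}[\varphi]$ is real valued, radially symmetric and positive (and one writes $\mathcal{F}[\varphi](\xi)=\mathcal{F}[\varphi](|\xi|)$); (c) the function $\psi(s):=s^{\frac{N-1}{2}}\mathcal{F}[\varphi](s)$ belongs to $C^1(0,\infty)$ and $\psi'(s)\le 0$ for all $s\in(0,\infty)$. Then $[S(t)\varphi](x)>0$ for all $(x,t)\in\mathbb{R}^N\times(0,\infty)$.
   Context: $\mathcal{S}$ is the Schwartz space on $\mathbb{R}^N$, $\mathcal{S}'$ its dual (tempered distributions), and $\langle\cdot,\cdot\rangle$ the (bilinear) duality pairing between $\mathcal{S}'$ and $\mathcal{S}$. The Fourier transform is normalised by $\mathcal{F}[\varphi](\xi)=(2\pi)^{-N/2}\int_{\mathbb{R}^N}e^{-ix\cdot\xi}\varphi(x)\,dx$ and extended to $\mathcal{S}'$ as usual. $G(x,t)$ denotes the fundamental solution of $\partial_t+(-\Delta)^2$ in $\mathbb{R}^N\times(0,\infty)$. For each $t>0$, $G(\cdot,t)\in\mathcal{S}$ and $\mathcal{F}[G(\cdot,t)](\xi)=(2\pi)^{-N/2}e^{-t|\xi|^4}$, i.e. $G(x,t)=(2\pi)^{-N}\int_{\mathbb{R}^N}e^{ix\cdot\xi-t|\xi|^4}\,d\xi$. For $\varphi\in\mathcal{S}'$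 and $(x,t)\in\mathbb{R}^N\times(0,\infty)$, set $[S(t)\varphi](x):=\langle\varphi,G(x-\cdot,t)\rangle$. *)

(* Defs.v *)
From HB Require Import structures.
From mathcomp Require Import all_boot all_order all_algebra.
From mathcomp Require Import all_classical all_reals all_analysis.
From mathcomp Require Import complex.

Set Implicit Arguments.
Unset Strict Implicit.
Unset Printing Implicit Defensive.
Import Order.TTheory GRing.Theory Num.Theory.
Import numFieldNormedType.Exports.
Import ComplexField.Normc.

Local Open Scope classical_set_scope.
Local Open Scope ring_scope.
Local Open Scope complex_scope.

(* The n-fold product measure on n.-tuple T: at each step, the image of the
   product of l with the previous measure under cons. *)
Section tuple_measure_step.
Context d (T : measurableType d) (R : realType) (n : nat).
Variable l : {sigma_finite_measure set T -> \bar R}.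
Variable m : {sigma_finite_measure set (n.-tuple T) -> \bar R}.

Definition tuple_cons (p : T * n.-tuple T) : n.+1.-tuple T :=
  [tuple of p.1 :: p.2].

Lemma measurable_tuple_cons : measurable_fun [set: T * n.-tuple T] tuple_cons.
Proof. exact: measurable_cons. Qed.

Definition tuple_measure_cons : set (n.+1.-tuple T) -> \bar R :=
  pushforward (l \x m)%E tuple_cons.

Let cons0 : tuple_measure_cons set0 = 0%E.
Proof. by rewrite /tuple_measure_cons /pushforward preimage_set0 measure0. Qed.

Let cons_ge0 A : (0 <= tuple_measure_cons A)%E.
Proof. by rewrite /tuple_measure_cons /pushforward; apply: measure_ge0. Qed.

Let cons_sigma_additive : semi_sigma_additive tuple_measure_cons.
Proof.
move=> F mF tF mUF; rewrite /tuple_measure_cons /pushforward preimage_bigcup.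
have mp A : measurable A -> measurable (tuple_cons @^-1` A).
  by move=> mA; rewrite -[X in measurable X]setTI; exact: measurable_tuple_cons.
apply: measure_semi_sigma_additive.
- by move=> k; exact: mp.
- apply/trivIsetP => /= i j _ _ ij; rewrite -preimage_setI.
  by move/trivIsetP : tF => /(_ _ _ _ _ ij) ->//; rewrite preimage_set0.
- by rewrite -preimage_bigcup; exact: mp.
Qed.

HB.instance Definition _ := isMeasure.Build _ _ _ tuple_measure_cons
  cons0 cons_ge0 cons_sigma_additive.

Let cons_sigma_finite : sigma_finite setT tuple_measure_cons.
Proof.
have [F UF mF] : sigma_finite setT (l \x m)%E.
  have /sigma_finiteP[F [TF ndF Foo]] := sigma_finiteT l.
  have /sigma_finiteP[G [TG ndG Goo]] := sigma_finiteT m.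
  exists (fun k => F k `*` G k).
    rewrite -setXTT TF TG predeqE => -[x y]; split.
      move=> [/= [i _ Fx] [j _ Gy]]; exists (maxn i j) => //; split.
      - by move: x Fx; exact/subsetPset/ndF/leq_maxl.
      - by move: y Gy; exact/subsetPset/ndG/leq_maxr.
    by move=> [i _ []/= ? ?]; split; exists i.
  move=> k; have [? ?] := Foo k; have [? ?] := Goo k.
  split; first exact: measurableX.
  by rewrite product_measure1E// lte_mul_pinfty// ge0_fin_numE.
pose g (t : n.+1.-tuple T) : T * n.-tuple T := (thead t, [tuple of behead t]).
have gK : cancel tuple_cons g.
  move=> [x t]; rewrite /g /tuple_cons /=; congr pair.
  exact/val_inj.
have mg : measurable_fun setT g.
  apply/measurable_fun_pair; last exact: measurable_behead.
  exact: (measurable_tnth ord0).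
exists (fun k => g @^-1` F k).
  by rewrite -preimage_bigcup -UF preimage_setT.
move=> k; split.
  by rewrite -[X in measurable X]setTI; apply: mg => //; have [] := mF k.
rewrite /tuple_measure_cons /pushforward -comp_preimage.
rewrite (_ : g \o tuple_cons = id); last by apply/funext => x; exact: gK.
by rewrite preimage_id; have [] := mF k.
Qed.

HB.instance Definition _ := @Measure_isSigmaFinite.Build _ _ _
  tuple_measure_cons cons_sigma_finite.

End tuple_measure_step.

Fixpoint tuple_measure d (T : measurableType d) (R : realType)
    (l : {sigma_finite_measure set T -> \bar R}) (n : nat) :
    {sigma_finite_measure set (n.-tuple T) -> \bar R} :=
  if n is k.+1 then tuple_measure_cons l (tuple_measure l k)
  else \d_([tuple] : 0.-tuple T).

Lemma tuple_measure_box d (T : measurableType d) (R : realType)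
    (l : {sigma_finite_measure set T -> \bar R}) (n : nat) (A : 'I_n -> set T) :
  (forall i, measurable (A i)) ->
  tuple_measure l n [set t | forall i, A i (tnth t i)] = (\prod_(i < n) l (A i))%E.
Proof.
elim: n A => [|n IH] A mA.
  rewrite big_ord0 /= diracE mem_set// => -[].
  by [].
rewrite big_ord_recl -(IH (A \o lift ord0)); last by move=> i; exact: mA.
rewrite /= /tuple_measure_cons /pushforward.
set B := [set t : n.-tuple T | _ ].
rewrite (_ : _ @^-1` _ = A ord0 `*` B); last first.
  apply/seteqP; split => -[x t] /=.
    move=> h; split; first exact: (h ord0).
    by move=> i; have := h (lift ord0 i); rewrite tnthS.
  move=> [h0 h] i; have [->//|i0] := eqVneq i ord0.
  by case: (unliftP ord0 i) i0 => [j ->|->]//; rewrite ?eqxx// tnthS => _; exact: h.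
rewrite product_measure1E//.
rewrite (_ : B = \bigcap_(i in [set: 'I_n]) (fun t => tnth t i) @^-1` A (lift ord0 i)).
  apply: fin_bigcap_measurable => // i _.
  rewrite -[X in measurable X]setTI; apply: measurable_tnth => //; exact: mA.
by apply/seteqP; split => t /= h i; [move=> _|]; exact: h.
Qed.

Definition lebesgue_tuple (R : realType) (n : nat) :
    {sigma_finite_measure set (n.-tuple (measurableTypeR R)) -> \bar R} :=
  tuple_measure (@lebesgue_measure R) n.

Section euclidean_space.
Context (R : realType) (N : nat).
Local Notation V := ('rV[R]_N).
Local Notation C := (R[i]).

Definition dotp (x y : V) : R := \sum_(i < N) x ord0 i * y ord0 i.

(* The library norm of 'rV[R]_N is the sup norm; this is the Euclidean one. *)
Definition enorm (x : V) : R := Num.sqrt (dotp x x).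

Definition expi (a : R) : C := cos a +i* sin a.

Definition vec_of (t : N.-tuple (measurableTypeR R)) : V :=
  \row_(i < N) (tnth t i : R).

Definition integrableC (g : V -> C) : Prop :=
  (lebesgue_tuple R N).-integrable setT
    (fun t => (complex.Re (g (vec_of t)))%:E) /\
  (lebesgue_tuple R N).-integrable setT
    (fun t => (complex.Im (g (vec_of t)))%:E).

Definition integralC (g : V -> C) : C :=
  Rintegral (lebesgue_tuple R N) setT (fun t => complex.Re (g (vec_of t))) +i*
  Rintegral (lebesgue_tuple R N) setT (fun t => complex.Im (g (vec_of t))).

Definition partial (i : 'I_N) (f : V -> C) : V -> C := fun x =>
  'D_(delta_mx ord0 i) (fun y : V => complex.Re (f y) : R^o) x +i*
  'D_(delta_mx ord0 i) (fun y : V => complex.Im (f y) : R^o) x.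

(* Multi-indices are lists of coordinates: [:: i1; ...; ik] stands for
   d_{i1} ... d_{ik} and for the monomial x_{i1} ... x_{ik}. *)
Definition partials (b : seq 'I_N) (f : V -> C) : V -> C :=
  foldr partial f b.

Definition monomial (a : seq 'I_N) (x : V) : R := \prod_(i <- a) x ord0 i.

Definition smooth (f : V -> C) : Prop :=
  forall (b : seq 'I_N) (x : V),
    differentiable (fun y : V => complex.Re (partials b f y) : R^o) x /\
    differentiable (fun y : V => complex.Im (partials b f y) : R^o) x.

Definition schwartz (f : V -> C) : Prop :=
  smooth f /\
  forall a b : seq 'I_N, exists M : R,
    forall x : V, normc ((monomial a x)%:C * partials b f x) <= M.

Definition seminorm (a b : seq 'I_N) (f : V -> C) : R :=
  sup (range (fun x : V => normc ((monomial a x)%:C * partials b f x))).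

(* A tempered distribution is encoded by a map defined on all functions
   V -> C, of which only the values on Schwartz functions are meaningful:
   there it is linear, and bounded by finitely many Schwartz seminorms, which
   is continuity for the usual topology of the Schwartz space. *)
Definition functional := (V -> C) -> C.

Definition tempered (T : functional) : Prop :=
  (forall (a : C) (f g : V -> C), schwartz f -> schwartz g ->
     T (fun x => a * f x + g x) = a * T f + T g) /\
  exists (M : R) (s : seq (seq 'I_N * seq 'I_N)),
    forall f : V -> C, schwartz f ->
      normc (T f) <= M * \sum_(p <- s) seminorm p.1 p.2 f.

Definition fourier (f : V -> C) : V -> C := fun xi =>
  ((2 * pi) `^ (- (N%:R / 2)))%:C *
  integralC (fun x => expi (- dotp x xi) * f x).

Definition fourier_dist (T : functional) : functional :=
  fun f => T (fourier f).

Definition mul_dist (w : V -> C) (T : functional) : functional :=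
  fun f => T (fun x => w x * f x).

(* T belongs to L^1 and is the function g, under the canonical embedding of
   L^1 into the tempered distributions.  When T is w times a distribution U
   with w > 0, and g is w * h, this says that U is the function h and that
   w * h is integrable. *)
Definition is_L1_dist (T : functional) (g : V -> C) : Prop :=
  integrableC g /\
  forall f : V -> C, schwartz f -> T f = integralC (fun x => g x * f x).

Definition exp_quartic (t : R) (xi : V) : C := (expR (- t * enorm xi ^+ 4))%:C.

Definition biharmonic_kernel (t : R) (x : V) : C :=
  ((2 * pi) ^- N)%:C *
  integralC (fun xi => expi (dotp x xi) * exp_quartic t xi).

Definition biharmonic_semigroup (phi : functional) (t : R) (x : V) : C :=
  phi (fun y => biharmonic_kernel t (x - y)).

Definition weighted_profile (f : R -> R) : R -> R :=
  fun s => s `^ ((N%:R - 1) / 2) * f s.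

End euclidean_space.

(* Main.v *)
(* Testing the hypothesis at time t/2 against the Schwartz function
   exp(i x.xi) exp(-t |xi|^4 / 2) turns S(t)phi(x) into the Fourier integral of
   the radial function G(|xi|), G(s) = exp(-t s^4) F[phi](s).  Its imaginary part
   vanishes because the integral over R^N of H(|xi|, x.xi) depends on x only
   through |x|.  With N = m + 3 and c = |x|, its real part is a positive multiple
   of the integral over s > 0 of h(s) u(s), where h(s) = s^((N-1)/2) G(s) is
   positive and strictly decreasing and
     u(s) = s^((N-1)/2) int_[-1,1] cos(c s t) (1 - t^2)^((N-3)/2) dt
   solves u'' = - (c^2 - kappa / s^2) u with kappa = (N-1)(N-3)/4 >= 0.
   Since c^2 - kappa / s^2 is nondecreasing, Sturm comparison of u with its
   reflection at a zero shows that each negative arch of u is dominated by the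
   positive arch before it, so the primitive of u is nonnegative; writing h as a
   superposition of indicators of intervals ]0, S[ gives the positivity.
   Only integrals of nonnegative functions are transformed: cos is replaced by
   1 + cos, and the two finite integrals are compared at the end. *)
Require Import Defs.
From HB Require Import structures.
From mathcomp Require Import all_boot all_order all_algebra.
From mathcomp Require Import all_classical all_reals all_analysis.
From mathcomp Require Import measurable_realfun complex.
From mathcomp Require Import ring lra.
Set Implicit Arguments.
Unset Strict Implicit.
Unset Printing Implicit Defensive.
Import Order.TTheory GRing.Theory Num.Theory.
Import numFieldNormedType.Exports.
Import ComplexField.Normc.
Local Open Scope classical_set_scope.
Local Open Scope ring_scope.
Local Open Scope complex_scope.

(** * One-variable calculus and Sturm comparison *)

(** Taking out exp(-t |xi|^4) at time t itself would leave the bare phase exp(i x.xi), which is not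
    a Schwartz function; with half of the exponential given to the distribution and half to the test
    function, the L^1 hypothesis can be tested. The polar Jacobian s^(N-1) is shared evenly between
    h and u. One half is exactly the weight in psi; the other half brings Bessel's equation to the
    normal form without first-order term, which is what makes u and its reflection comparable. With
    a = (N-1)/2 one has kappa = a (a - 1), so N >= 3 enters as a >= 1. psi may be constant: the
    strict decrease of h, hence the strict inequality, comes from the exponential factor. At the
    origin F[phi] may be singular, so h may be unbounded near 0 and the radial formula holds only
    off a null set. Strictness is therefore extracted on a compact interval inside the first
    positive arch of u. *)

Section is_derive1_rules.
Context {R : realType}.
Implicit Types (f g : R -> R) (x df dg : R).

Lemma is_derive1D f g x df dg : is_derive x 1 f df -> is_derive x 1 g dg ->
  is_derive x 1 (fun s => f s + g s) (df + dg).
Proof. by move=> ? ?; exact: is_deriveD. Qed.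

Lemma is_derive1N f x df : is_derive x 1 f df -> is_derive x 1 (fun s => - f s) (- df).
Proof. by move=> ?; exact: is_deriveN. Qed.

Lemma is_derive1M f g x df dg : is_derive x 1 f df -> is_derive x 1 g dg ->
  is_derive x 1 (fun s => f s * g s) (df * g x + f x * dg).
Proof.
move=> ? ?; apply: (@is_derive_eq _ _ _ (f * g)).
by rewrite /GRing.scale /=; ring.
Qed.

Lemma is_derive1Z f (k : R) x df : is_derive x 1 f df ->
  is_derive x 1 (fun s => k * f s) (k * df).
Proof.
move=> H; apply: (@is_derive_eq _ _ _ _ _ _ _ _ (is_derive1M (is_derive_cst k x 1) H)).
by rewrite mul0r add0r.
Qed.

Lemma is_derive1_chain f g x df dg : is_derive x 1 g dg -> is_derive (g x) 1 f df ->
  is_derive x 1 (fun s => f (g s)) (df * dg).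
Proof.
move=> [dg1 dg2] [df1 df2]; split.
  have /derivable1_diffP Dg := dg1; have /derivable1_diffP Df := df1.
  exact/(derivable1_diffP _ _).2/(differentiable_comp Dg Df).
by have := derive1_comp dg1 df1; rewrite !derive1E dg2 df2 => <-.
Qed.

Lemma is_derive1_scale x (M : R) : is_derive x 1 (fun s => M * s) M.
Proof. by have := is_derive1Z M (is_derive_id x 1); rewrite mulr1. Qed.

Lemma is_derive1X f (n : nat) x df : is_derive x 1 f df ->
  is_derive x 1 (fun s => f s ^+ n) (n%:R * f x ^+ n.-1 * df).
Proof.
move=> H; rewrite (_ : (fun s => _) = f ^+ n); first exact: is_deriveX.
by apply/funext => s; rewrite exprfctE.
Qed.

Lemma is_derive1V f x df : f x != 0 -> is_derive x 1 f df ->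
  is_derive x 1 (fun s => (f s)^-1) (- (f x) ^- 2 * df).
Proof. by move=> fx H; exact: is_deriveV. Qed.

Lemma is_derive1_shiftl f (j x d : R) : is_derive (j + x) 1 f d ->
  is_derive x 1 (fun s => f (j + s)) d.
Proof.
move=> H; rewrite -[d]mulr1; apply: is_derive1_chain => //.
by have := is_derive1D (is_derive_cst j x 1) (is_derive_id x 1); rewrite add0r.
Qed.

Lemma is_derive1_reflect f (j x d : R) : is_derive (j - x) 1 f d ->
  is_derive x 1 (fun s => f (j - s)) (- d).
Proof.
move=> H; rewrite -mulrN1; apply: is_derive1_chain => //.
have := is_derive1D (is_derive_cst j x 1) (is_derive1N (is_derive_id x 1)).
by rewrite add0r.
Qed.

End is_derive1_rules.

Section sturm.
Context {R : realType}.
Implicit Types (f k u v q U : R -> R).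

Lemma is_derive_lt0_local k (x d : R) : is_derive x 1 k d -> d < 0 ->
  exists2 e, 0 < e & forall h, 0 < h < e -> k (x + h) < k x < k (x - h).
Proof.
move=> [dk kd] d0.
have : h^-1 *: (k (h *: 1 + x) - k x) @[h --> 0^'] --> d by rewrite -kd.
move=> /cvgr_lt /(_ _ d0)[e /= e0 He]; exists e => // h /andP[h0 he].
apply/andP; split.
- have := He h; rewrite /ball_ /= sub0r normrN gtr0_norm// => /(_ he).
  rewrite gt_eqF// => /(_ isT).
  by rewrite /GRing.scale /= mulr1 (addrC h) pmulr_rlt0 ?invr_gt0// subr_lt0.
- have := He (- h); rewrite /ball_ /= sub0r opprK gtr0_norm// => /(_ he).
  rewrite oppr_eq0 gt_eqF// => /(_ isT).
  rewrite /GRing.scale /= mulr1 (addrC (- h)) invrN mulNr oppr_lt0.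
  by rewrite pmulr_rgt0 ?invr_gt0// subr_gt0.
Qed.

Lemma is_derive_within f (df : R -> R) (a b : R) :
  (forall x, a <= x <= b -> is_derive x 1 f (df x)) -> {within `[a, b], continuous f}.
Proof.
move=> H; apply: derivable_within_continuous => x; rewrite in_itv/= => /H.
by case.
Qed.

Lemma is_derive_le0_noninc f df (a b : R) : a <= b ->
  {within `[a, b], continuous f} ->
  (forall x, a < x < b -> is_derive x 1 f (df x)) ->
  (forall x, a < x < b -> df x <= 0) -> f b <= f a.
Proof.
rewrite le_eqVlt => /predU1P[->//|ab] cf H H0.
have H' x : x \in `]a, b[ -> is_derive x 1 f (df x) by rewrite in_itv/=; exact: H.
have [c] := MVT ab H' cf; rewrite in_itv/= => cab; rewrite -subr_le0 => ->.
by rewrite mulr_le0_ge0 ?H0// subr_ge0 ltW.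
Qed.

(* Gronwall for the energy [u ^ 2 + v ^ 2] *)
Lemma ode_zero_data u v q (s0 j M : R) : s0 <= j ->
  (forall s, s0 <= s <= j -> is_derive s 1 u (v s)) ->
  (forall s, s0 <= s <= j -> is_derive s 1 v (- q s * u s)) ->
  (forall s, s0 <= s <= j -> `|1 - q s| <= M) ->
  u j = 0 -> v j = 0 -> u s0 = 0.
Proof.
move=> s0j du dv qM uj vj.
(* The energy has derivative [2 u v (1 - q)], which is at least [- M] times the energy. Multiplied
   by [expR (M * s)] it is nondecreasing, so its vanishing at [j] propagates backwards to [s0]; [E]
   is the opposite of this product. *)
pose E s := - ((u s ^+ 2 + v s ^+ 2) * expR (M * s)).
pose dE s := - ((2 * (u s * v s) * (1 - q s) + M * (u s ^+ 2 + v s ^+ 2)) * expR (M * s)).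
have DE s : s0 <= s <= j -> is_derive s 1 E (dE s).
  move=> sj; have Du := du _ sj; have Dv := dv _ sj.
  have H := is_derive1N (is_derive1M (is_derive1D (is_derive1X 2 Du) (is_derive1X 2 Dv))
    (is_derive1_chain (is_derive1_scale s M) (is_derive_expR (M * s)))).
  by apply: (@is_derive_eq _ _ _ _ _ _ _ _ H); rewrite /dE /=; ring.
have : E j <= E s0.
  apply: (@is_derive_le0_noninc E dE _ _ s0j).
  - exact: is_derive_within DE.
  - by move=> s /andP[/ltW a /ltW b]; apply: DE; rewrite a b.
  - move=> s /andP[/ltW a /ltW b]; have := qM s; rewrite a b => /(_ isT).
    rewrite ler_norml => /andP[m1 m2].
    rewrite /dE oppr_le0 mulr_ge0 ?expR_ge0//.
    have := sqr_ge0 (u s + v s); have := sqr_ge0 (u s - v s); nra.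
rewrite /E uj vj expr0n /= addr0 mul0r oppr0 oppr_ge0 pmulr_lle0 ?expR_gt0// => H.
apply/eqP; rewrite -sqrf_eq0 eq_le sqr_ge0 andbT.
by apply: le_trans H; rewrite lerDl sqr_ge0.
Qed.

(** The point is the maximum of the compact set where [f <= 0] on [[a, b]]. Were [f] negative there,
    the intermediate value theorem would give a zero further to the right. *)
Lemma last_zero f (a b : R) : continuous f -> a <= b -> f a <= 0 -> 0 < f b ->
  exists p, [/\ a <= p, p < b, f p = 0 & forall s, p < s -> s <= b -> 0 < f s].
Proof.
move=> cf ab fa fb.
pose A := `[a, b] `&` f @^-1` [set y | y <= 0].
have cA : compact A.
  apply: (subclosed_compact _ (@segment_compact _ a b)); last by move=> ? [].
  apply: closedI; first exact: interval_closed.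
  by apply: closed_comp; [move=> ? _; exact: cf|exact: closed_le].
have A0 : A !=set0 by exists a; split => //=; rewrite in_itv/= lexx.
have cid : {within A, continuous (id : R -> R)}.
  by apply: continuous_subspaceT => x; exact: cvg_id.
have [p /set_mem[/= + fp] pmax] := compact_EVT_max A0 cA cid.
rewrite in_itv/= => /andP[ap pb].
have H s : p < s -> s <= b -> 0 < f s.
  move=> ps sb; rewrite ltNge; apply/negP => fs.
  have /pmax : s \in A.
    by apply/mem_set; split => //=; rewrite in_itv/= sb (le_trans ap (ltW ps)).
  by rewrite leNgt ps.
have pltb : p < b.
  rewrite lt_neqAle pb andbT; apply/eqP => pE; move: fb.
  by rewrite -pE ltNge fp.
exists p; split => //; apply/eqP; rewrite eq_le fp /= leNgt; apply/negP => fp0.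
have [|c + fc] := @IVT R f p b 0 pb (continuous_subspaceT cf).
  by rewrite ge_min le_max (ltW fp0) (ltW fb) orbT.
rewrite in_itv/= => /andP[]; rewrite le_eqVlt => /predU1P[pc|pc] cb.
  by move: fp0; rewrite pc fc ltxx.
by have := H _ pc cb; rewrite fc ltxx.
Qed.

Lemma continuous_ge0_endpoint f (b : R) : continuous f -> 0 < b ->
  (forall s, 0 < s < b -> 0 <= f s) -> 0 <= f b.
Proof.
move=> cf b0 f0; rewrite leNgt; apply/negP => fb.
have [e /= e0 He] := cvgr_lt _ (cf b) _ fb.
pose h := Num.min (e / 2) (b / 2).
have h0 : 0 < h by rewrite lt_min !divr_gt0.
have he : h <= e / 2 by rewrite ge_min lexx.
have hb : h <= b / 2 by rewrite ge_min lexx orbT.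
have := He (b - h); rewrite /ball_ /= opprB addrC subrK gtr0_norm//.
have -> : h < e by lra.
by move=> /(_ isT); rewrite ltNge f0//; apply/andP; split; lra.
Qed.

Section reflection.
Variables u v q : R -> R.
Hypothesis du : forall s : R, 0 < s -> is_derive s 1 u (v s).
Hypothesis dv : forall s : R, 0 < s -> is_derive s 1 v (- q s * u s).
Hypothesis qnd : forall s t : R, 0 < s -> s <= t -> q s <= q t.

(* Wronskian argument: [u (j - r) / - u (j + r)] is nondecreasing in [r] and
   tends to [1] at [0]. *)
Lemma reflection_le_pos (j r1 : R) : r1 <= j -> u j = 0 -> v j < 0 ->
  (forall r, 0 < r < r1 -> 0 < u (j - r)) ->
  (forall r, 0 < r < r1 -> u (j + r) < 0) ->
  forall r, 0 < r < r1 -> - u (j + r) <= u (j - r).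
Proof.
move=> r1j uj vj up un r /andP[r0 rr1]; rewrite leNgt; apply/negP => fg.
pose f s := u (j - s); pose g s := - u (j + s).
pose f' s := - v (j - s); pose g' s := - v (j + s).
pose W s := f s * g' s - f' s * g s.
have j0 : 0 < j by exact: lt_le_trans (lt_trans r0 rr1) r1j.
have Df s : 0 <= s < j -> is_derive s 1 f (f' s).
  by move=> /andP[s0 sj]; apply/is_derive1_reflect/du; rewrite subr_gt0.
have Dg s : 0 <= s < j -> is_derive s 1 g (g' s).
  by move=> /andP[s0 sj]; apply/is_derive1N/is_derive1_shiftl/du; rewrite ltr_wpDr.
have DW s : 0 <= s < j -> is_derive s 1 W ((q (j - s) - q (j + s)) * (f s * g s)).
  move=> sj; have /andP[s0 sj'] := sj.
  have jms : 0 < j - s by rewrite subr_gt0.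
  have jps : 0 < j + s by rewrite ltr_wpDr.
  have Df' : is_derive s 1 f' (- (q (j - s) * u (j - s))).
    have := is_derive1N (is_derive1_reflect (dv jms)).
    by rewrite mulNr opprK.
  have Dg' : is_derive s 1 g' (q (j + s) * u (j + s)).
    by have := is_derive1N (is_derive1_shiftl (dv jps)); rewrite mulNr opprK.
  have H := is_derive1D (is_derive1M (Df _ sj) Dg') (is_derive1N (is_derive1M Df' (Dg _ sj))).
  by apply: (@is_derive_eq _ _ _ _ _ _ _ _ H); rewrite /f /g; ring.
(* The Wronskian vanishes at [0] because [u j = 0], and its derivative has the sign of
   [q (j - s) - q (j + s) <= 0]. *)
have W0 s : 0 <= s <= r -> W s <= 0.
  move=> /andP[s0 sr].
  have <- : W 0 = 0 by rewrite /W /f /g subr0 addr0 uj mul0r oppr0 mulr0 subrr.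
  have sub x : 0 <= x <= s -> 0 <= x < j.
    by move=> /andP[-> xs] /=; exact: le_lt_trans (le_trans xs sr) (lt_le_trans rr1 r1j).
  apply: (is_derive_le0_noninc s0) => [|x /andP[/ltW x0 /ltW xs]|x /andP[x0 xs]].
  - by apply: is_derive_within => x /sub /DW.
  - by apply: DW; apply: sub; rewrite x0.
  - have xr1 : 0 < x < r1.
      by rewrite x0 (lt_trans xs)// (le_lt_trans sr).
    have xj : x < j by move/andP : xr1 => [_ /lt_le_trans]; exact.
    apply: mulr_le0_ge0; first by rewrite subr_le0 qnd// ?subr_gt0// lerD2l; lra.
    by apply: mulr_ge0; [apply/ltW/up|rewrite oppr_ge0; apply/ltW/un].
have gp s : 0 < s <= r -> 0 < g s.
  by move=> /andP[s0 sr]; rewrite oppr_gt0 un// s0 (le_lt_trans sr).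
have g0 : 0 < g r by rewrite gp// r0 lexx.
(* If the bound fails at [r], the ratio [f / g] equals [l < 1] there and, being nondecreasing, stays
   at most [l] on []0, r]]. *)
pose l := f r / g r.
have l1 : l < 1 by rewrite ltr_pdivrMr// mul1r.
have rho s : 0 < s <= r -> f s - l * g s <= 0.
  move=> sr; have /andP[s0 sr'] := sr.
  rewrite subr_le0 -ler_pdivrMr ?gp// -lerN2.
  pose drho x := W x / g x ^+ 2.
  have D x : s <= x <= r -> is_derive x 1 (fun x => - (f x / g x)) (drho x).
    move=> /andP[sx xr].
    have xj : 0 <= x < j.
      by rewrite (le_trans (ltW s0) sx) (le_lt_trans xr (lt_le_trans rr1 r1j)).
    have gx : g x != 0 by rewrite gt_eqF// gp// (lt_le_trans s0 sx).
    have H := is_derive1N (is_derive1M (Df _ xj) (is_derive1V gx (Dg _ xj))).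
    apply: (@is_derive_eq _ _ _ _ _ _ _ _ H); rewrite /drho /W.
    by field.
  apply: (@is_derive_le0_noninc (fun x => - (f x / g x)) drho _ _ sr')
    => [|x /andP[/ltW x0 /ltW xs]|x /andP[/ltW x0 /ltW xs]].
  - exact: is_derive_within D.
  - by apply: D; rewrite x0.
  - by apply: mulr_le0_ge0; rewrite ?invr_ge0 ?sqr_ge0// W0// xs andbT (le_trans (ltW s0)).
(* The contradiction: [f - l * g] vanishes at [0] with slope [- (1 - l) * v j > 0], so it is
   positive just after [0], against [rho]. *)
have j00 : 0 <= (0 : R) < j by rewrite lexx.
have Dk := is_derive1N (is_derive1D (Df _ j00) (is_derive1N (is_derive1Z l (Dg _ j00)))).
have [|e e0 He] := is_derive_lt0_local Dk.
  rewrite /f' /g' subr0 addr0.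
  have : 0 < (1 - l) * (- v j) by rewrite mulr_gt0 ?subr_gt0 ?oppr_gt0.
  lra.
pose h := Num.min (e / 2) r.
have h0 : 0 < h by rewrite lt_min r0 divr_gt0.
have he : h < e by rewrite gt_min; apply/orP; left; rewrite ltr_pdivrMr// ltr_pMr// ltr1n.
have := He h; rewrite h0 he => /(_ isT)/andP[+ _].
have -> : f 0 = 0 by rewrite /f subr0.
have -> : g 0 = 0 by rewrite /g addr0 uj oppr0.
rewrite add0r mulr0 subr0 oppr0 oppr_lt0.
by rewrite ltNge rho// h0 ge_min lexx orbT.
Qed.


Hypothesis cu : continuous u.
Hypothesis u0 : u 0 = 0.

(** Neither the positivity of [u] on the reflected interval nor the fact that this interval stays
    inside []0, j[] is known beforehand; both come from the comparison itself. If [u] had a zero [p]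
    in the reflected interval, the comparison on []p, j[] would give in the limit
    [- u (2 j - p) <= u p = 0], against [un]. If [d >= j], the limit at [r = j] gives
    [- u (2 j) <= u 0 = 0], again impossible. *)
Lemma reflection_le (j d : R) : 0 < j -> 0 < d -> u j = 0 -> v j < 0 ->
  (forall r, 0 < r <= d -> u (j + r) < 0) ->
  d < j /\ forall r, 0 < r < d -> - u (j + r) <= u (j - r).
Proof.
move=> j0 d0 uj vj un.
have [e e0 He] := is_derive_lt0_local (du j0) vj.
pose D := Num.min d j.
have Dj : D <= j by rewrite ge_min lexx orbT.
have Dd : D <= d by rewrite ge_min lexx.
have D0 : 0 < D by rewrite lt_min d0.
have unD r1 : r1 <= d -> forall r, 0 < r < r1 -> u (j + r) < 0.
  by move=> r1d r /andP[r0 rr1]; rewrite un// r0 (le_trans (ltW rr1)).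
pose F s := u (j - s) + u (j + s).
have cF : continuous F.
  move=> s; apply: cvgD.
    apply: (@continuous_comp _ _ _ (fun s => j - s) u); last exact: cu.
    by apply: cvgB; [exact: cvg_cst|exact: cvg_id].
  apply: (@continuous_comp _ _ _ (fun s => j + s) u); last exact: cu.
  by apply: cvgD; [exact: cvg_cst|exact: cvg_id].
have upD r : 0 < r < D -> 0 < u (j - r).
  move=> /andP[r0 rD]; rewrite ltNge; apply/negP => ur.
  have er : e <= r.
    rewrite leNgt; apply/negP => re; move: ur; rewrite leNgt.
    by have := He r; rewrite r0 re uj => /(_ isT)/andP[_ ->].
  have he0 : 0 < e / 2 by rewrite divr_gt0.
  have hee : e / 2 < e by rewrite ltr_pdivrMr// ltr_pMr// ltr1n.
  have jre : j - r <= j - e / 2 by rewrite lerD2l lerN2 (le_trans (ltW hee)).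
  have uje : 0 < u (j - e / 2).
    by have := He (e / 2); rewrite he0 hee uj => /(_ isT)/andP[_ ->].
  (* The search stops at [j - e / 2] because [u j = 0]; between there and [j] the sign of [u] comes
     from the slope at [j]. *)
  have [p [rp pe up0 upos]] := last_zero cu jre ur uje.
  have r1p : j - p < D by lra.
  have p0 : 0 < p by lra.
  have pj : p < j by lra.
  have comp s : 0 < s < j - p -> - u (j + s) <= u (j - s).
    apply: reflection_le_pos => //.
    - by lra.
    - move=> {}s /andP[s0 sp]; have [se|es] := ltP s e.
        by have := He s; rewrite s0 se uj => /(_ isT)/andP[_ ->].
      by apply: upos; lra.
    - by apply: unD; lra.
  have : - u (j + (j - p)) <= u (j - (j - p)).
    rewrite -subr_ge0.
    have -> : u (j - (j - p)) - - u (j + (j - p)) = F (j - p) by rewrite opprK.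
    apply: continuous_ge0_endpoint => //; first by lra.
    by move=> s /comp; rewrite -subr_ge0 opprK.
  rewrite (_ : j - (j - p) = p) ?up0 ?oppr_le0 ?leNgt ?un//; last by ring.
  by apply/andP; split; lra.
have comp : forall r, 0 < r < D -> - u (j + r) <= u (j - r).
  by apply: reflection_le_pos => //; exact: unD.
have dj : d < j.
  rewrite ltNge; apply/negP => jd.
  have : 0 <= F j.
    apply: continuous_ge0_endpoint => // s sj.
    rewrite /F -lerBlDr sub0r comp// /D.
    by rewrite (min_idPr jd).
  by rewrite /F subrr u0 add0r leNgt un// j0.
by split => // r; have := comp r; rewrite /D (min_idPl (ltW dj)).
Qed.

(** The arches of [u] are not enumerated. If [U] were negative somewhere, a tilted [U] would have a
    minimiser [z] with [u z < 0], inside a negative arch starting at some zero [j]. Reflection at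
    [j] gives [U (2 j - z) <= U z] with [2 j - z < z], so the tilted function is strictly smaller at
    [2 j - z]. *)
Lemma sturm_integral_ge0 U : (forall s : R, 0 < s -> is_derive s 1 U (u s)) ->
  U 0 = 0 -> (forall Z, {within `[0, Z], continuous U}) ->
  (exists2 e, 0 < e & forall s, 0 < s < e -> 0 < u s) ->
  forall Z, 0 <= Z -> 0 <= U Z.
Proof.
move=> dU U0 cU [e e0 ue] Z; rewrite le_eqVlt => /predU1P[<-|Z0]; first by rewrite U0.
rewrite leNgt; apply/negP => UZ.
(* The tilt [eps * s] forces [u < 0] at the minimiser and makes every earlier
   point with a value of [U] at most [U z] contradict minimality. *)
pose eps := - U Z / (2 * Z).
have eps0 : 0 < eps by rewrite divr_gt0 ?oppr_gt0 ?mulr_gt0.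
have epsZ : U Z + eps * Z < 0.
  rewrite /eps (_ : - U Z / (2 * Z) * Z = - U Z / 2); last by field; rewrite gt_eqF.
  by lra.
pose V s := U s + eps * s.
have cV : {within `[0, Z], continuous V}.
  move=> x; apply: cvgD; first exact: cU.
  by apply: cvgM; [exact: cvg_cst|exact: (continuous_subspaceT (fun _ => cvg_id))].
have [z + zmin] := EVT_min (ltW Z0) cV.
rewrite in_itv/= => /andP[z0 zZ].
have Vz : V z < 0.
  by apply: le_lt_trans epsZ; apply: zmin; rewrite in_itv/= lexx ltW.
have {}z0 : 0 < z.
  rewrite lt_neqAle z0 andbT; apply/eqP => zE.
  by move: Vz; rewrite /V -zE U0 mulr0 addr0 ltxx.
have uz : u z < 0.
  apply: (@le_lt_trans _ _ (- eps)); last by rewrite oppr_lt0.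
  (* A slope of [V] that is positive at [z] makes [V] smaller just to the left. Only the left side
     is used, since [z] may be the endpoint [Z]. *)
  rewrite leNgt; apply/negP => uz.
  have DV := is_derive1N (is_derive1D (dU _ z0) (is_derive1_scale z eps)).
  have [|d d0 Hd] := is_derive_lt0_local DV; first by lra.
  pose h := Num.min (d / 2) (z / 2).
  have h0 : 0 < h by rewrite lt_min !divr_gt0.
  have hd : h <= d / 2 by rewrite ge_min lexx.
  have hz : h <= z / 2 by rewrite ge_min lexx orbT.
  have hd' : h < d by lra.
  have := Hd h; rewrite h0 hd' => /(_ isT)/andP[_]; rewrite ltrN2 -/(V _) -/(V z).
  by rewrite ltNge zmin// in_itv/=; apply/andP; split; lra.
have cNu : continuous (fun s => - u s) by move=> x; apply: cvgN; exact: cu.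
have [j [j0 jz uj un]] : exists j, [/\ 0 <= j, j < z, - u j = 0 &
    forall s, j < s -> s <= z -> 0 < - u s].
  by apply: last_zero => //; rewrite ?u0 ?oppr0 ?oppr_gt0// ltW.
move/eqP : uj; rewrite oppr_eq0 => /eqP uj.
have {}j0 : 0 < j.
  rewrite lt_neqAle j0 andbT; apply/eqP => jE.
  pose h := Num.min (e / 2) z.
  have h0 : 0 < h by rewrite lt_min z0 divr_gt0.
  have he : h <= e / 2 by rewrite ge_min lexx.
  have hz : h <= z by rewrite ge_min lexx orbT.
  have := un h; rewrite -jE h0 hz => /(_ isT isT); rewrite oppr_gt0 ltNge ltW// ue//.
  by apply/andP; split; lra.
(* [v j > 0] contradicts [u < 0] just after [j]. [v j = 0] would be zero Cauchy data, and uniqueness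
   would force [u] to vanish near [0], where it is positive. *)
have vj : v j < 0.
  rewrite lt_neqAle; apply/andP; split.
    apply/eqP => vj.
    pose s0 := Num.min (e / 2) j.
    have s00 : 0 < s0 by rewrite lt_min j0 divr_gt0.
    have s0e : s0 <= e / 2 by rewrite ge_min lexx.
    have s0j : s0 <= j by rewrite ge_min lexx orbT.
    suff : u s0 = 0 by apply/eqP; rewrite gt_eqF// ue//; apply/andP; split; lra.
    (* [q] is monotone, so on [[s0, j]] the quantity [1 - q] lies between its two end values. *)
    apply: (@ode_zero_data u v q s0 j (`|1 - q s0| + `|1 - q j|)) => //.
    - by move=> s /andP[s1 _]; apply: du; lra.
    - by move=> s /andP[s1 _]; apply: dv; lra.
    - move=> s /andP[s1 s2].
      have q1 := qnd s00 s1; have q2 := qnd (lt_le_trans s00 s1) s2.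
      have := ler_norm (1 - q s0); have := ler_norm (- (1 - q j)).
      have := normr_ge0 (1 - q s0); have := normr_ge0 (1 - q j).
      by rewrite normrN ler_norml => *; apply/andP; split; lra.
  rewrite leNgt; apply/negP => vj.
  have [|d d0 Hd] := is_derive_lt0_local (is_derive1N (du j0)); first by lra.
  pose h := Num.min (d / 2) (z - j).
  have h0 : 0 < h by rewrite lt_min subr_gt0 jz divr_gt0.
  have hd : h <= d / 2 by rewrite ge_min lexx.
  have hz : h <= z - j by rewrite ge_min lexx orbT.
  have hd' : h < d by lra.
  have := Hd h; rewrite h0 hd' uj oppr0 => /(_ isT)/andP[+ _].
  by rewrite ltNge ltW// un//; lra.
have zj0 : 0 < z - j by rewrite subr_gt0.
have [r rr|dj comp] := reflection_le j0 zj0 uj vj.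
  by rewrite -oppr_gt0 un//; lra.
pose Phi s := U (j - s) - U (j + s).
have DPhi s : 0 <= s <= z - j -> is_derive s 1 Phi (- u (j - s) - u (j + s)).
  move=> /andP[s0 sz]; apply: is_derive1D.
    by apply/is_derive1_reflect/dU; lra.
  by apply/is_derive1N/is_derive1_shiftl/dU; lra.
have : Phi (z - j) <= Phi 0.
  apply: (@is_derive_le0_noninc Phi (fun s => - u (j - s) - u (j + s)) _ _ (ltW zj0)).
  - exact: is_derive_within DPhi.
  - by move=> s /andP[/ltW s0 /ltW sz]; apply: DPhi; rewrite s0.
  - by move=> s /comp; lra.
rewrite /Phi subr0 addr0 subrr subr_le0 (addrC j (z - j)) subrK => UU.
have : V z <= V (j - (z - j)) by apply: zmin; rewrite in_itv/=; apply/andP; split; lra.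
rewrite /V; nra.
Qed.

End reflection.
End sturm.

(** * Rotation invariance of the product Lebesgue measure *)

Section lebesgue_change_of_variables.
Context {R : realType}.
Local Notation T := (measurableTypeR R).
Local Notation leb := (@lebesgue_measure R).
Local Open Scope ereal_scope.

Lemma measurable_affine (c a : R) : measurable_fun setT (fun x : T => (c * x + a)%R : T).
Proof. by apply: measurable_funD => //; exact: measurable_funM. Qed.

(** The image of Lebesgue measure under the affine map, multiplied by [c], agrees with Lebesgue
    measure on half-open intervals, hence everywhere by uniqueness. *)
Lemma ge0_integral_affine (k : T -> \bar R) (c a : R) : (0 < c)%R ->
  measurable_fun setT k -> (forall x, 0 <= k x) ->
  \int[leb]_x k x = c%:E * \int[leb]_x k (c * x + a)%R.
Proof.
move=> c0 mk k0.
pose g (x : T) : T := (c * x + a)%R.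
have mg : measurable_fun setT g := measurable_affine c a.
pose nu : {measure set T -> \bar R} :=
  measure_function_pushforward__canonical__measure_function_Measure leb mg.
pose c' : {nonneg R} := NngNum (ltW c0).
transitivity (\int[mscale c' nu]_x k x).
  apply: eq_measure_integral => A mA _; apply: lebesgue_measure_unique => // X [[x y] _ <-].
  have E : g @^-1` `]x, y] = `]((x - a) / c)%R, ((y - a) / c)%R]%classic.
    apply/seteqP; split => z /=; rewrite /g !in_itv/= ltr_pdivrMr// ler_pdivlMr//.
      by rewrite ltrBlDr lerBrDr mulrC.
    by rewrite ltrBlDr lerBrDr mulrC.
  change (leb `]x, y]%classic = c%:E * leb (g @^-1` `]x, y]%classic)).
  rewrite E !lebesgue_measure_itv/= !lte_fin ltr_pM2r ?invr_gt0// ltrD2r.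
  case: ifPn => _; last by rewrite mule0.
  by rewrite -!EFinB -EFinM; congr EFin; field; exact: lt0r_neq0.
rewrite ge0_integral_mscale//; congr (_ * _).
by rewrite ge0_integral_pushforward.
Qed.

Lemma ge0_integral_opp (k : T -> \bar R) : measurable_fun setT k ->
  (forall x, 0 <= k x) -> \int[leb]_x k x = \int[leb]_x k (- x)%R.
Proof.
move=> mk k0.
transitivity (\int[pushforward leb (-%R : T -> T)]_x k x).
  by apply: eq_measure_integral => A mA _; exact/esym/lebesgue_measureN.
by rewrite ge0_integral_pushforward.
Qed.

Lemma ge0_integral_shear1 (Phi : T * T -> \bar R) (a : R) :
  measurable_fun setT Phi -> (forall x, 0 <= Phi x) ->
  \int[leb]_u \int[leb]_v Phi (u, v) = \int[leb]_u \int[leb]_v Phi ((u + a * v)%R, v).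
Proof.
move=> mPhi Phi0.
have mPhi' : measurable_fun setT (fun z : T * T => Phi ((z.1 + a * z.2)%R, z.2)).
  apply: (measurableT_comp mPhi); apply/measurable_fun_pair => //=.
  by apply: measurable_funD => //; exact: measurable_funM.
have F1 := @fubini_tonelli _ _ _ _ R leb leb _ mPhi Phi0.
have F2 := @fubini_tonelli _ _ _ _ R leb leb _ mPhi' (fun z => Phi0 _).
apply: (etrans F1); apply/esym/(etrans F2)/esym.
apply: eq_integral => v _.
have mk : measurable_fun setT (fun u : T => Phi (u, v)).
  by apply: (measurableT_comp mPhi); exact: measurable_pair2.
apply: (etrans (ge0_integral_affine (a * v)%R ltr01 mk (fun u => Phi0 _))).
by rewrite mul1e; apply: eq_integral => u _; rewrite mul1r.
Qed.

Lemma ge0_integral_shear2 (Phi : T * T -> \bar R) (a : R) :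
  measurable_fun setT Phi -> (forall x, 0 <= Phi x) ->
  \int[leb]_u \int[leb]_v Phi (u, v) = \int[leb]_u \int[leb]_v Phi (u, (v + a * u)%R).
Proof.
move=> mPhi Phi0; apply: eq_integral => u _.
have mk : measurable_fun setT (fun v : T => Phi (u, v)).
  by apply: (measurableT_comp mPhi); exact: measurable_pair1.
apply: (etrans (ge0_integral_affine (a * u)%R ltr01 mk (fun v => Phi0 _))).
by rewrite mul1e; apply: eq_integral => v _; rewrite mul1r.
Qed.

(* A plane rotation of angle [t <> pi] is the product of the three shears of
   parameters [tan (t / 2)], [- sin t] and [tan (t / 2)]. *)
Lemma ge0_integral_rotation (Phi : T * T -> \bar R) (C S : R) :
  (C ^+ 2 + S ^+ 2 = 1)%R -> measurable_fun setT Phi -> (forall x, 0 <= Phi x) ->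
  \int[leb]_u \int[leb]_v Phi (u, v) =
  \int[leb]_u \int[leb]_v Phi ((C * u + S * v)%R, (C * v - S * u)%R).
Proof.
move=> CS mPhi Phi0.
have mlin (a b c d : R) : measurable_fun setT (fun z : T * T =>
    ((a * z.1 + b * z.2)%R, (c * z.1 + d * z.2)%R) : T * T).
  apply/measurable_fun_pair => /=; apply: measurable_funD => //; exact: measurable_funM.
(* The half turn, which has no half-angle tangent, is handled as two sign changes. *)
have [C1|C1] := eqVneq C (-1)%R.
  have S0 : S = 0%R by apply/eqP; rewrite -sqrf_eq0; apply/eqP; move: CS; rewrite C1 sqrrN expr1n; lra.
  have mF : measurable_fun setT (fun u : T => \int[leb]_v Phi (u, v)).
    exact: (@measurable_fun_fubini_tonelli_F _ _ _ _ R leb _ mPhi Phi0).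
  have F0 (u : T) : 0 <= \int[leb]_v Phi (u, v) by exact: integral_ge0.
  apply: (etrans (ge0_integral_opp mF F0)).
  apply: eq_integral => u _.
  have mk : measurable_fun setT (fun v : T => Phi ((- u)%R, v)).
    by apply: (measurableT_comp mPhi); exact: measurable_pair1.
  apply: (etrans (ge0_integral_opp mk (fun v => Phi0 _))).
  by apply: eq_integral => v _; rewrite C1 S0 !mulN1r !mul0r subr0 addr0.
have C1' : (1 + C != 0)%R by rewrite addrC addr_eq0.
(* With [C] and [S] the cosine and sine of the angle, this is the tangent of the half angle. [E1]
   and [E2] below identify the entries of the product of the three shears. *)
pose t := (S / (1 + C))%R.
have SE : (S ^+ 2 = (1 - C) * (1 + C))%R by move: CS; lra.
have E1 : (1 - t * S = C)%R.
  have -> : (t * S = S ^+ 2 / (1 + C))%R by rewrite /t expr2; ring.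
  by rewrite SE mulfK// opprB addrC subrK.
pose Phi1 (z : T * T) := Phi ((z.1 + t * z.2)%R, z.2).
pose Phi2 (z : T * T) := Phi1 (z.1, (z.2 + - S * z.1)%R).
have mPhi1 : measurable_fun setT Phi1.
  apply: (measurableT_comp mPhi).
  by have := mlin 1%R t 0%R 1%R; under eq_fun do rewrite !mul1r mul0r add0r.
have mPhi2 : measurable_fun setT Phi2.
  apply: (measurableT_comp mPhi1).
  by have := mlin 1%R 0%R (- S)%R 1%R; under eq_fun do rewrite !mul1r mul0r addr0 addrC.
apply: (etrans (ge0_integral_shear1 t mPhi Phi0)).
apply: (etrans (ge0_integral_shear2 (- S)%R mPhi1 (fun z => Phi0 _))).
apply: (etrans (ge0_integral_shear1 t mPhi2 (fun z => Phi0 _))).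
apply: eq_integral => u _; apply: eq_integral => v _; rewrite /Phi2 /Phi1 /=; congr (Phi (_, _)).
  have E2 : (t * (2 - t * S) = S)%R.
    by rewrite (_ : 2 - t * S = 1 + C)%R ?mulfVK// -E1; ring.
  by rewrite -[in RHS]E2 -{1}E1; ring.
by rewrite -{1}E1; ring.
Qed.


Lemma ge0_integral_rotation_radial (K : T * T -> \bar R) (a b : R) :
  measurable_fun setT K -> (forall x, 0 <= K x) ->
  \int[leb]_u \int[leb]_v K ((u ^+ 2 + v ^+ 2)%R, (a * u + b * v)%R) =
  \int[leb]_u \int[leb]_v K ((u ^+ 2 + v ^+ 2)%R, (Num.sqrt (a ^+ 2 + b ^+ 2) * u)%R).
Proof.
move=> mK K0; set c := Num.sqrt _.
have ab0 : (0 <= a ^+ 2 + b ^+ 2)%R by rewrite addr_ge0 ?sqr_ge0.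
have [ab|ab] := eqVneq (a ^+ 2 + b ^+ 2)%R 0%R.
  have -> : a = 0%R by apply/eqP; rewrite -sqrf_eq0 eq_le sqr_ge0 andbT -ab lerDl sqr_ge0.
  have -> : b = 0%R by apply/eqP; rewrite -sqrf_eq0 eq_le sqr_ge0 andbT -ab lerDr sqr_ge0.
  rewrite /c ab sqrtr0.
  by apply: eq_integral => u _; apply: eq_integral => v _; rewrite !mul0r addr0.
have c0 : (0 < c)%R by rewrite sqrtr_gt0 lt_neqAle eq_sym ab.
have c2 : (c ^+ 2 = a ^+ 2 + b ^+ 2)%R by rewrite sqr_sqrtr.
have CS : ((a / c) ^+ 2 + (b / c) ^+ 2 = 1)%R.
  by rewrite !expr_div_n -mulrDl -c2 divff// expf_neq0// gt_eqF.
pose Phi (z : T * T) := K ((z.1 ^+ 2 + z.2 ^+ 2)%R, (c * z.1)%R).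
have mPhi : measurable_fun setT Phi.
  apply: (measurableT_comp mK); apply/measurable_fun_pair => /=.
    by apply: measurable_funD; exact: measurable_funX.
  exact: measurable_funM.
apply/esym/(etrans (ge0_integral_rotation CS mPhi (fun z => K0 _))).
apply: eq_integral => u _; apply: eq_integral => v _; rewrite /Phi /=; congr (K (_, _)).
  transitivity (((a / c) ^+ 2 + (b / c) ^+ 2) * (u ^+ 2 + v ^+ 2))%R; first by ring.
  by rewrite CS mul1r.
by field; rewrite gt_eqF.
Qed.

End lebesgue_change_of_variables.

(** * Reduction of a linear form to a single coordinate *)

Section lebesgue_tuple_integral.
Context {R : realType}.
Local Notation T := (measurableTypeR R).
Local Notation leb := (@lebesgue_measure R).
Local Notation L n := (lebesgue_tuple R n).
Local Open Scope ereal_scope.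

Lemma ge0_integral_lebesgue_tupleS n (F : n.+1.-tuple T -> \bar R) :
  measurable_fun setT F -> (forall t, 0 <= F t) ->
  \int[L n.+1]_t F t = \int[leb]_u \int[L n]_t F (tuple_cons (u, t)).
Proof.
move=> mF F0.
transitivity (\int[pushforward (leb \x L n) (@tuple_cons _ T n)]_t F t) => //.
rewrite ge0_integral_pushforward//; last exact: measurable_tuple_cons.
rewrite preimage_setT.
have mF' : measurable_fun setT (F \o @tuple_cons _ T n).
  exact: (measurableT_comp mF (@measurable_tuple_cons _ _ _)).
by rewrite (@fubini_tonelli1 _ _ _ _ R leb (L n) _ mF')// => x; exact: F0.
Qed.

Definition sqn n (t : n.-tuple T) : R := \sum_(i < n) (tnth t i : R) ^+ 2.

Definition tdot n (x : 'I_n -> R) (t : n.-tuple T) : R :=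
  \sum_(i < n) x i * (tnth t i : R).

Lemma measurable_sqn n : measurable_fun setT (@sqn n : _ -> T).
Proof. by apply: measurable_sum => i; apply: measurable_funX; exact: measurable_tnth. Qed.

Lemma measurable_tdot n x : measurable_fun setT (@tdot n x : _ -> T).
Proof.
by apply: measurable_sum => i; apply: measurable_funM => //; exact: measurable_tnth.
Qed.

Lemma sqn_cons n u (t : n.-tuple T) : sqn (tuple_cons (u, t)) = (u ^+ 2 + sqn t)%R.
Proof. by rewrite /sqn big_ord_recl; congr (_ + _)%R; apply: eq_bigr => i _; rewrite tnthS. Qed.

Lemma tdot_cons n x u (t : n.-tuple T) :
  tdot x (tuple_cons (u, t)) = (x ord0 * u + tdot (x \o lift ord0) t)%R.
Proof. by rewrite /tdot big_ord_recl; congr (_ + _)%R; apply: eq_bigr => i _; rewrite tnthS. Qed.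

Lemma sqn_ge0 n (t : n.-tuple T) : (0 <= sqn t)%R.
Proof. by apply: sumr_ge0 => i _; exact: sqr_ge0. Qed.

Lemma measurable_thead n : measurable_fun setT (fun t : n.+1.-tuple T => thead t).
Proof. exact: (measurable_tnth ord0). Qed.

Lemma measurable_pair_fun d (X : measurableType d) (H : T * T -> \bar R) (a b : X -> T) :
  measurable_fun setT H -> measurable_fun setT a -> measurable_fun setT b ->
  measurable_fun setT (fun x => H (a x, b x)).
Proof.
by move=> mH ma mb; apply: (measurableT_comp mH); exact/measurable_fun_pair.
Qed.

(** Plane rotations suffice. The induction hypothesis turns the form in the last [n.+1] coordinates
    into a multiple of the second coordinate alone, and a rotation of the first two coordinates then
    merges the two terms. In dimension one only the sign of [x ord0] has to be removed. *)
Lemma ge0_integral_tuple_rotation n (H : T * T -> \bar R) (x : 'I_n.+1 -> R) :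
  measurable_fun setT H -> (forall z, 0 <= H z) ->
  \int[L n.+1]_t H (sqn t, tdot x t) =
  \int[L n.+1]_t H (sqn t, Num.sqrt (\sum_(i < n.+1) x i ^+ 2) * (thead t : R))%R.
Proof.
elim: n H x => [|n IH] H x mH H0.
  have mG (c : R) : measurable_fun setT (fun t : 1.-tuple T => H (sqn t, (c * (thead t : R))%R)).
    apply: measurable_pair_fun => //; first exact: measurable_sqn.
    by apply: measurable_funM => //; exact: measurable_thead.
  have -> : \int[L 1]_t H (sqn t, tdot x t) =
      \int[L 1]_t H (sqn t, (x ord0 * (thead t : R))%R).
    by apply: eq_integral => t _; rewrite /tdot big_ord_recl big_ord0 addr0.
  rewrite big_ord_recl big_ord0 addr0 sqrtr_sqr.
  have [x0|x0] := leP 0%R (x ord0); first by rewrite ger0_norm.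
  apply: (etrans (ge0_integral_lebesgue_tupleS (mG _) (fun t => H0 _))).
  apply/esym/(etrans (ge0_integral_lebesgue_tupleS (mG _) (fun t => H0 _)))/esym.
  pose g (u : T) := \int[L 0]_t H (sqn (tuple_cons (u, t)), (x ord0 * u)%R).
  have mg : measurable_fun setT g.
    pose G (z : T * 0.-tuple T) := H (sqn (tuple_cons z), (x ord0 * z.1)%R).
    have mGz : measurable_fun setT G.
      apply: measurable_pair_fun => //.
        exact: (measurableT_comp (@measurable_sqn _) (@measurable_tuple_cons _ _ _)).
      exact: measurable_funM.
    exact: (@measurable_fun_fubini_tonelli_F _ _ _ _ R (L 0) G mGz (fun z => H0 _)).
  have g0 (u : T) : 0 <= g u by exact: integral_ge0.
  apply: (etrans (ge0_integral_opp mg g0)).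
  apply: eq_integral => u _; apply: eq_integral => t _.
  by rewrite !sqn_cons sqrrN theadE ltr0_norm// mulrN mulNr.
set c' := Num.sqrt (\sum_(i < n.+1) (x (lift ord0 i)) ^+ 2)%R.
have -> : (\sum_(i < n.+2) x i ^+ 2 = x ord0 ^+ 2 + c' ^+ 2)%R.
  by rewrite big_ord_recl sqr_sqrtr// sumr_ge0// => i _; exact: sqr_ge0.
set c := Num.sqrt _.
(* The coordinates untouched by the plane rotation are integrated out, so that a function of two
   variables remains. *)
pose K (z : T * T) := \int[L n]_s H ((z.1 + sqn s)%R, z.2).
have mK : measurable_fun setT K.
  pose G (z : (T * T) * n.-tuple T) := H ((z.1.1 + sqn z.2)%R, z.1.2).
  have mG : measurable_fun setT G.
    apply: measurable_pair_fun => //; last exact: (measurableT_comp measurable_snd).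
    apply: measurable_funD; first exact: (measurableT_comp measurable_fst).
    exact: (measurableT_comp (@measurable_sqn _)).
  exact: (@measurable_fun_fubini_tonelli_F _ _ _ _ R (L n) G mG (fun z => H0 _)).
have K0 z : 0 <= K z by exact: integral_ge0.
have step (a b : R) : \int[leb]_u \int[L n.+1]_t H ((u ^+ 2 + sqn t)%R, (a * u + b * (thead t : R))%R) =
    \int[leb]_u \int[leb]_v K ((u ^+ 2 + v ^+ 2)%R, (a * u + b * v)%R).
  apply: eq_integral => u _.
  have mF : measurable_fun setT (fun t : n.+1.-tuple T =>
      H ((u ^+ 2 + sqn t)%R, (a * u + b * (thead t : R))%R)).
    apply: measurable_pair_fun => //.
      by apply: measurable_funD => //; exact: measurable_sqn.
    by apply: measurable_funD => //; apply: measurable_funM => //; exact: measurable_thead.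
  apply: (etrans (ge0_integral_lebesgue_tupleS mF (fun t => H0 _))).
  apply: eq_integral => v _; apply: eq_integral => s _ /=.
  by rewrite sqn_cons theadE addrA.
have mF1 : measurable_fun setT (fun t : n.+2.-tuple T => H (sqn t, tdot x t)).
  by apply: measurable_pair_fun => //; [exact: measurable_sqn|exact: measurable_tdot].
have mF2 : measurable_fun setT (fun t : n.+2.-tuple T => H (sqn t, (c * (thead t : R))%R)).
  apply: measurable_pair_fun => //; first exact: measurable_sqn.
  by apply: measurable_funM => //; exact: measurable_thead.
apply: (etrans (ge0_integral_lebesgue_tupleS mF1 (fun t => H0 _))).
apply/esym/(etrans (ge0_integral_lebesgue_tupleS mF2 (fun t => H0 _)))/esym.
transitivity (\int[leb]_u \int[L n.+1]_t H ((u ^+ 2 + sqn t)%R, (x ord0 * u + c' * (thead t : R))%R)).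
  apply: eq_integral => u _.
  pose Hu (z : T * T) := H ((u ^+ 2 + z.1)%R, (x ord0 * u + z.2)%R).
  have mHu : measurable_fun setT Hu by apply: measurable_pair_fun => //; exact: measurable_funD.
  rewrite -(IH Hu (x \o lift ord0) mHu (fun z => H0 _)).
  by apply: eq_integral => t _; rewrite /Hu sqn_cons tdot_cons.
rewrite step (ge0_integral_rotation_radial _ _ mK K0).
(* The null coefficient of [thead t] lets [step] be used backwards with [b = 0]. *)
transitivity (\int[leb]_u \int[L n.+1]_t H ((u ^+ 2 + sqn t)%R, (c * u + 0 * (thead t : R))%R)).
  rewrite step; apply: eq_integral => u _; apply: eq_integral => v _.
  by rewrite mul0r addr0.
apply: eq_integral => u _; apply: eq_integral => t _.
by rewrite sqn_cons theadE mul0r addr0.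
Qed.

End lebesgue_tuple_integral.

(** * Radial integration *)

Section density.
Context d (X : measurableType d) (R : realType).
Variables (mu : {measure set X -> \bar R}) (rho : X -> R).
Hypotheses (mrho : measurable_fun setT rho) (rho0 : forall x, 0 <= rho x).
Local Open Scope ereal_scope.

Definition density_measure (A : set X) : \bar R := \int[mu]_(x in A) (rho x)%:E.

Let density0 : density_measure set0 = 0.
Proof. by rewrite /density_measure integral_set0. Qed.

Let density_ge0 A : 0 <= density_measure A.
Proof. by apply: integral_ge0 => x _; rewrite lee_fin. Qed.

Let density_sigma_additive : semi_sigma_additive density_measure.
Proof.
move=> F mF tF mUF; rewrite /density_measure; apply: cvg_toP.
  apply: ereal_nondecreasing_is_cvgn => m n mn.
  by apply: lee_sum_nneg_natr => // k _ _; exact: density_ge0.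
rewrite ge0_integral_bigcup//=; last by move=> x _; rewrite lee_fin.
exact/measurable_EFinP/measurable_funTS.
Qed.

HB.instance Definition _ := isMeasure.Build _ _ _ density_measure
  density0 density_ge0 density_sigma_additive.

Import HBNNSimple.

Lemma ge0_integral_density (f : X -> \bar R) : measurable_fun setT f ->
  (forall x, 0 <= f x) ->
  \int[density_measure]_x f x = \int[mu]_x (f x * (rho x)%:E).
Proof.
move=> mf f0; pose f_ := nnsfun_approx measurableT mf.
have cf x : EFin \o f_ ^~ x @ \oo --> f x by exact: cvg_nnsfun_approx.
have mE : measurable_fun setT (EFin \o rho) by exact/measurable_EFinP.
transitivity (limn (fun n => \int[density_measure]_x (f_ n x)%:E)).
  rewrite -monotone_convergence//.
  - by apply: eq_integral => x _; apply/esym/cvg_lim => //; exact: cf.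
  - by move=> n; exact/measurable_EFinP.
  - by move=> n x _; rewrite lee_fin.
  - by move=> x _ a b ab; rewrite lee_fin; exact/lefP/nd_nnsfun_approx.
transitivity (limn (fun n => \int[mu]_x ((f_ n x)%:E * (rho x)%:E))); last first.
  rewrite -monotone_convergence//.
  - apply: eq_integral => x _; apply/cvg_lim => //.
    by apply: cvgeZr => //; exact: cf.
  - by move=> n; apply: emeasurable_funM => //; exact/measurable_EFinP.
  - by move=> n x _; rewrite mule_ge0// lee_fin.
  - move=> x _ a b ab; rewrite lee_wpmul2r ?lee_fin//; exact/lefP/nd_nnsfun_approx.
congr (limn _); apply/funext => n.
transitivity (\sum_(k \in range (f_ n)) k%:E * density_measure (f_ n @^-1` [set k])).
  under eq_integral do rewrite fimfunE -fsumEFin//.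
  rewrite ge0_integral_fsum//; last 2 first.
  - by move=> y; exact/measurable_EFinP/measurable_funM.
  - by move=> y x _; rewrite nnfun_muleindic_ge0.
  apply: eq_fsbigr => r _; rewrite integralZl_indic_nnsfun//.
  by rewrite integral_indic// setIT.
transitivity (\int[mu]_x (\sum_(k \in range (f_ n))
    (k * \1_(f_ n @^-1` [set k]) x)%:E * (rho x)%:E)); last first.
  apply: eq_integral => x _; rewrite fimfunE -fsumEFin// ge0_mule_fsuml// => k.
  by rewrite EFinM nnfun_muleindic_ge0.
rewrite ge0_integral_fsum//; last 2 first.
- by move=> y; apply: emeasurable_funM => //; exact/measurable_EFinP/measurable_funM.
- by move=> k x _; rewrite mule_ge0 ?lee_fin// -lee_fin EFinM nnfun_muleindic_ge0.
apply: eq_fsbigr => k /set_mem[x0 _ <-]; set A := f_ n @^-1` _.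
rewrite /density_measure integral_mkcond -ge0_integralZl//; last 3 first.
- apply/(measurable_restrictT _ _).1; last exact: measurable_funTS.
  by rewrite /A -[X in measurable X]setTI; exact: (@measurable_funP _ _ _ _ _ (f_ n)).
- by move=> x _; rewrite patchE; case: ifP; rewrite ?lee_fin.
- by rewrite lee_fin.
apply: eq_integral => x _; rewrite patchE indicE.
by case: (x \in A); rewrite /= ?mulr1 ?mulr0 ?mul0e ?mule0.
Qed.

End density.

Lemma measure_rays_unique (R : realType) (m1 m2 : {measure set (measurableTypeR R) -> \bar R}) :
  (forall x : R, m1 `]-oo, x[%classic = m2 `]-oo, x[%classic) ->
  (forall x : R, m1 `]-oo, x[%classic < +oo)%E ->
  forall A, measurable A -> m1 A = m2 A.
Proof.
move=> m12 m1oo A mA.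
apply: (@measure_unique _ R (measurableTypeR R) (@RGenInftyO.G R)
  (fun n : nat => `]-oo, n%:R[%classic) _ _ _ _ m1 m2 _ _ A mA) => //.
- exact: RGenInftyO.measurableE.
- move=> _ _ [x ->] [y ->]; exists (Num.min x y).
  by apply/seteqP; split => z /=; rewrite !in_itv/= lt_min; [move=> [-> ->]|move/andP].
- by move=> n; exists n%:R.
- rewrite -subTset => x _; exists (Num.truncn `|x|).+1 => //=; rewrite in_itv/=.
  by rewrite (le_lt_trans (ler_norm _))// truncnS_gt.
- by move=> _ [x ->]; exact: m12.
Qed.

(** A substitute for a change of variables: once the distribution function of [phi] is known to have
    density [rho], integrals of functions of [phi] become one-dimensional. It will be used with
    [phi] a radius, whose distribution function is a ball volume. *)
Lemma ge0_integral_pushforward_density d (X : measurableType d) (R : realType)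
    (mu : {measure set X -> \bar R}) (phi : X -> measurableTypeR R) (rho : R -> R)
    (k : measurableTypeR R -> \bar R) :
  measurable_fun setT phi -> measurable_fun setT (rho : measurableTypeR R -> R) ->
  (forall s, 0 <= rho s) ->
  (forall s : R, mu [set x | (phi x < s)%R] =
     \int[@lebesgue_measure R]_(x in `]-oo, s[) (rho x)%:E)%E ->
  (forall s : R, mu [set x | (phi x < s)%R] < +oo)%E ->
  measurable_fun setT k -> (forall s, 0 <= k s)%E ->
  (\int[mu]_x k (phi x) = \int[@lebesgue_measure R]_s (k s * (rho s)%:E))%E.
Proof.
move=> mphi mrho rho0 murho muoo mk k0.
pose nu := measure_function_pushforward__canonical__measure_function_Measure mu mphi.
transitivity (\int[nu]_s k s)%E; first by apply/esym; rewrite [LHS](ge0_integral_pushforward mphi mu measurableT mk).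
rewrite -(ge0_integral_density _ mrho rho0 mk k0).
by apply: eq_measure_integral => A mA _; exact: measure_rays_unique.
Qed.

Section ball_volume.
Context {R : realType}.
Local Notation T := (measurableTypeR R).
Local Notation leb := (@lebesgue_measure R).
Local Notation L n := (lebesgue_tuple R n).

(* The indicator makes this vanish on [y <= 0] even for [n = 0]. *)
Definition pos_sqrtX (n : nat) (y : R) : R := \1_(`]0, +oo[%classic : set R) y * Num.sqrt y ^+ n.

Lemma pos_sqrtX_ge0 n y : 0 <= pos_sqrtX n y.
Proof. by rewrite mulr_ge0 ?exprn_ge0 ?sqrtr_ge0// indicE. Qed.

Lemma pos_sqrtX_gt0 n y : 0 < y -> pos_sqrtX n y = Num.sqrt y ^+ n.
Proof.
by move=> y0; rewrite /pos_sqrtX indicE mem_set ?mul1r//= in_itv/= y0.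
Qed.

Lemma pos_sqrtX_le0 n y : y <= 0 -> pos_sqrtX n y = 0.
Proof.
move=> y0; rewrite /pos_sqrtX indicE memNset ?mul0r//= in_itv/= andbT.
by apply/negP; rewrite -leNgt.
Qed.

Lemma measurable_sqrt : measurable_fun setT (Num.sqrt : T -> T).
Proof. by apply: continuous_measurable_fun; exact: sqrt_continuous. Qed.

Lemma measurable_pos_sqrtX n : measurable_fun setT (pos_sqrtX n : T -> T).
Proof.
apply: measurable_funM; first exact: measurable_indic.
by apply: measurable_funX; exact: measurable_sqrt.
Qed.

Lemma integral_indic_segment (a b : R) : a <= b ->
  (\int[leb]_x (\1_(`[a, b]%classic : set T) x)%:E = (b - a)%:E)%E.
Proof.
move=> ab; rewrite integral_indic//.
rewrite setIT; apply: (etrans (lebesgue_measure_itv `[a, b])).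
by rewrite /= lte_fin; case: ltgtP ab => // [->] _; rewrite subrr.
Qed.

(** Finiteness and positivity are obtained by squeezing: the integrand is at most [1] and supported
    in [[-1, 1]], while on [[-1/2, 1/2]], of length one, [1 - x ^+ 2 >= 3 / 4]. *)
Lemma integral_pos_sqrtX n : exists2 I : R, 0 < I &
  (\int[leb]_x (pos_sqrtX n (1 - x ^+ 2))%:E = I%:E)%E.
Proof.
have mf : measurable_fun setT (fun x : T => (pos_sqrtX n (1 - x ^+ 2))%:E).
  apply/measurable_EFinP/(measurableT_comp (@measurable_pos_sqrtX n)).
  by apply: measurable_funB => //; exact: measurable_funX.
have f0 (x : T) : (0 <= (pos_sqrtX n (1 - x ^+ 2))%:E)%E by rewrite lee_fin pos_sqrtX_ge0.
have up : (\int[leb]_x (pos_sqrtX n (1 - x ^+ 2))%:E <= 2%:E)%E.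
  have -> : 2%:E = (\int[leb]_x (\1_(`[(-1)%R, 1%R]%classic : set T) x)%:E)%E.
    by rewrite integral_indic_segment ?opprK//; lra.
  apply: ge0_le_integral => //.
  - by apply/measurable_EFinP; exact: measurable_indic.
  - move=> x _; rewrite lee_fin.
    have [x1|x1] := leP (1 - x ^+ 2) 0; first by rewrite pos_sqrtX_le0// indicE.
    have x11 : `|x| <= 1 by rewrite -(@expr_le1 _ 2)// real_normK ?num_real//; lra.
    rewrite indicE mem_set/=; last by rewrite in_itv/= -ler_norml.
    rewrite pos_sqrtX_gt0// exprn_ile1 ?sqrtr_ge0// -[leRHS]sqrtr1 ler_sqrt//.
    by rewrite lerBlDr lerDl sqr_ge0.
have lo : ((Num.sqrt (3 / 4) ^+ n)%:E <= \int[leb]_x (pos_sqrtX n (1 - x ^+ 2))%:E)%E.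
  have -> : (Num.sqrt (3 / 4) ^+ n)%:E = (\int[leb]_x
      ((Num.sqrt (3 / 4) ^+ n)%:E * (\1_(`[(- (1 / 2))%R, (1 / 2)%R]%classic : set T) x)%:E))%E.
    rewrite ge0_integralZl//; last by apply/measurable_EFinP; exact: measurable_indic.
    rewrite integral_indic_segment; last by lra.
    by rewrite -EFinM; congr EFin; field.
  apply: ge0_le_integral => //.
  - apply/measurable_EFinP; apply: measurable_funM => //; exact: measurable_indic.
  - move=> x _; rewrite -EFinM lee_fin indicE.
    have [/set_mem/=|] := boolP (x \in _); last by rewrite mulr0 pos_sqrtX_ge0.
    rewrite in_itv/= mulr1 => /andP[x1 x2].
    have x34 : 3 / 4 <= 1 - x ^+ 2 by nra.
    have x0 : 0 < 1 - x ^+ 2 by lra.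
    by rewrite pos_sqrtX_gt0// lerXn2r ?nnegrE ?sqrtr_ge0// ler_sqrt//; lra.
move: up lo; case: (\int[leb]_x _)%E => [I|//|//]; rewrite ?lee_fin => I2 I0; exists I => //.
by apply: lt_le_trans I0; rewrite exprn_gt0// sqrtr_gt0; lra.
Qed.

(** Here [r] is the squared radius. Slicing along the first coordinate gives balls of squared radius
    [r - u ^+ 2]; rescaling [u] by [Num.sqrt r] extracts the power of [r] and multiplies the
    constant by the integral [I]. *)
Lemma lebesgue_tuple_ball n : exists2 w : R, 0 < w &
  forall r, L n [set t | sqn t < r] = (w * pos_sqrtX n r)%:E.
Proof.
elim: n => [|n [w w0 IH]].
  exists 1 => // r; rewrite /= diracE mul1r.
  have [r0|r0] := leP r 0.
    by rewrite pos_sqrtX_le0// memNset//= /sqn big_ord0; apply/negP; rewrite -leNgt.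
  by rewrite pos_sqrtX_gt0// mem_set//= /sqn big_ord0.
have [I I0 IE] := integral_pos_sqrtX n.
exists (w * I) => [|r]; first by rewrite mulr_gt0.
have mball m s : measurable [set t : m.-tuple T | sqn t < s].
  have := @measurable_sqn R m measurableT `]-oo, s[%classic (measurable_itv _).
  by rewrite setTI; congr measurable; apply/seteqP; split => t /=; rewrite in_itv.
have ind m s : (L m [set t | (sqn t < s)%R] =
    \int[L m]_t (\1_[set t : m.-tuple T | (sqn t < s)%R] t)%:E)%E.
  by rewrite integral_indic ?setIT//; exact: mball.
transitivity (\int[leb]_u (w * pos_sqrtX n (r - u ^+ 2))%:E)%E.
  rewrite ind.
  rewrite ge0_integral_lebesgue_tupleS//; last first.
    by apply/measurable_EFinP; apply: measurable_indic; exact: mball.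
  apply: eq_integral => u _; rewrite -IH ind.
  apply: eq_integral => t _; rewrite !indicE; congr (_%:R%:E); congr nat_of_bool.
  by apply/idP/idP => /set_mem/= tr; apply/mem_set => /=; move: tr; rewrite sqn_cons ltrBrDl.
have [r0|r0] := leP r 0.
  rewrite pos_sqrtX_le0// mulr0; apply: integral0_eq => u _.
  by rewrite pos_sqrtX_le0 ?mulr0// (le_trans _ r0)// lerBlDr lerDl sqr_ge0.
have s0 : 0 < Num.sqrt r by rewrite sqrtr_gt0.
have mg : measurable_fun setT (fun u : T => (w * pos_sqrtX n (r - u ^+ 2))%:E).
  apply/measurable_EFinP/measurable_funM => //; apply: (measurableT_comp (@measurable_pos_sqrtX n)).
  by apply: measurable_funB => //; exact: measurable_funX.
have g0 (u : T) : (0 <= (w * pos_sqrtX n (r - u ^+ 2))%:E)%E.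
  by rewrite lee_fin mulr_ge0 ?pos_sqrtX_ge0// ltW.
apply: (etrans (ge0_integral_affine 0 s0 mg g0)).
have E u : (w * pos_sqrtX n (r - (Num.sqrt r * u + 0) ^+ 2))%:E =
    ((w * Num.sqrt r ^+ n)%:E * (pos_sqrtX n (1 - u ^+ 2))%:E)%E.
  rewrite addr0 exprMn sqr_sqrtr ?ltW// -EFinM; congr EFin.
  rewrite -[X in X - _]mulr1 -mulrBr -mulrA; congr (_ * _).
  have [u1|u1] := leP (1 - u ^+ 2) 0.
    by rewrite !pos_sqrtX_le0 ?mulr0// mulr_ge0_le0// ltW.
  by rewrite !pos_sqrtX_gt0 ?mulr_gt0// sqrtrM ?ltW// exprMn.
under eq_integral do rewrite E.
rewrite ge0_integralZl//; last 3 first.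
- apply/measurable_EFinP/(measurableT_comp (@measurable_pos_sqrtX n)).
  by apply: measurable_funB => //; exact: measurable_funX.
- by move=> x _; rewrite lee_fin pos_sqrtX_ge0.
- by rewrite lee_fin mulr_ge0 ?exprn_ge0// ltW.
rewrite IE -!EFinM pos_sqrtX_gt0// exprS; congr EFin; ring.
Qed.

End ball_volume.

Section radial_integral.
Context {R : realType}.
Local Notation T := (measurableTypeR R).
Local Notation leb := (@lebesgue_measure R).
Local Notation L n := (lebesgue_tuple R n).

Lemma is_derive_sqrtX (m : nat) (f : R -> R) (x df : R) : 0 < f x -> is_derive x 1 f df ->
  is_derive x 1 (fun s => Num.sqrt (f s) ^+ m.+2) (m.+2%:R / 2 * Num.sqrt (f x) ^+ m * df).
Proof.
move=> fx0 Df.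
have H := is_derive1X m.+2 (is_derive1_chain Df (is_derive1_sqrt fx0)).
apply: (@is_derive_eq _ _ _ _ _ _ _ _ H) => /=; rewrite exprS; field.
by rewrite gt_eqF// sqrtr_gt0.
Qed.

(** Up to a constant, the density in [s] of the radius [Num.sqrt (u ^+ 2 + sqn t)] when [t] runs
    over dimension [m.+2] and the extra coordinate [u] is fixed. The maximum with [0] makes it
    vanish for negative [s]. *)
Definition radial_density (m : nat) (u s : R) : R :=
  Num.max s 0 * pos_sqrtX m (s ^+ 2 - u ^+ 2).

Lemma radial_density_ge0 m u s : 0 <= radial_density m u s.
Proof. by rewrite mulr_ge0 ?pos_sqrtX_ge0// le_max lexx orbT. Qed.

Lemma measurable_radial_density m :
  measurable_fun setT (fun z : T * T => radial_density m z.1 z.2 : T).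
Proof.
apply: measurable_funM; first exact: measurable_maxr.
apply: (measurableT_comp (@measurable_pos_sqrtX R m)).
by apply: measurable_funB; exact: measurable_funX.
Qed.

Lemma radial_density0 m u s : s <= `|u| -> radial_density m u s = 0.
Proof.
move=> su; have [s0|s0] := leP s 0; first by rewrite /radial_density max_r ?mul0r.
rewrite /radial_density pos_sqrtX_le0 ?mulr0// subr_le0 -(real_normK (num_real u)).
by rewrite lerXn2r// nnegrE ?normr_ge0// ltW.
Qed.

Lemma radial_densityE m u s : `|u| < s ->
  radial_density m u s = s * Num.sqrt (s ^+ 2 - u ^+ 2) ^+ m.
Proof.
move=> us; have s0 : 0 < s by exact: le_lt_trans us.
rewrite /radial_density max_l ?ltW// pos_sqrtX_gt0// subr_gt0 -(real_normK (num_real u)).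
by rewrite ltrXn2r ?nnegrE ?normr_ge0 ?ltW//.
Qed.

(** The primitive [w * Num.sqrt (x ^+ 2 - u ^+ 2) ^+ m.+2] is a ball volume in dimension [m.+2], and
    differentiating it brings down the factor [m.+2]. It is differentiable only beyond [|u|], where
    it vanishes, so at that endpoint only continuity is used. *)
Lemma integral_radial_density m (u s w : R) : 0 < w ->
  (\int[leb]_(x in `]-oo, s[) (m.+2%:R * w * radial_density m u x)%:E =
   (if `|u| < s then w * pos_sqrtX m.+2 (s ^+ 2 - u ^+ 2) else 0)%:E)%E.
Proof.
move=> w0; have [us|us] := ltP; last first.
  apply: integral0_eq => x /=; rewrite in_itv/= => xs.
  by rewrite radial_density0 ?mulr0// (le_trans (ltW xs)).
have s0 : 0 < s by exact: le_lt_trans us.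
have us2 : 0 < s ^+ 2 - u ^+ 2.
  by rewrite subr_gt0 -(real_normK (num_real u)) ltrXn2r ?nnegrE ?normr_ge0 ?ltW.
pose f (x : R) := m.+2%:R * w * (x * Num.sqrt (x ^+ 2 - u ^+ 2) ^+ m).
have cs : continuous (fun x : R => Num.sqrt (x ^+ 2 - u ^+ 2) : R).
  move=> x; apply: (@continuous_comp _ _ _ (fun x : R => x ^+ 2 - u ^+ 2)); last exact: sqrt_continuous.
  by apply: cvgB; [exact: exprn_continuous|exact: cvg_cst].
have csX n : continuous (fun x : R => Num.sqrt (x ^+ 2 - u ^+ 2) ^+ n : R).
  move=> x; exact: (@continuous_comp _ _ _ (fun x : R => Num.sqrt (x ^+ 2 - u ^+ 2))
    (fun y : R => y ^+ n) x (cs x) (@exprn_continuous R n _)).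
have cf : continuous f.
  move=> x; apply: cvgM; first exact: cvg_cst.
  by apply: cvgM; [exact: cvg_id|exact: csX].
have mf : measurable_fun setT (fun x : T => (f x)%:E).
  by apply/measurable_EFinP; exact: continuous_measurable_fun.
transitivity (\int[leb]_(x in `]`|u|%R, s[) (f x)%:E)%E.
  rewrite integral_mkcond [RHS]integral_mkcond; apply: eq_integral => x _.
  rewrite !patchE !mem_setE !in_itv/=.
  have [ux|ux] := ltP `|u| x; last by rewrite /= radial_density0// mulr0 if_same.
  by case: ifP => //= xs; rewrite radial_densityE.
rewrite integral_itv_bndo_bndc; last exact: measurable_funTS.
rewrite integral_itv_obnd_cbnd; last exact: measurable_funTS.
pose F (x : R) := w * Num.sqrt (x ^+ 2 - u ^+ 2) ^+ m.+2.
have DF (x : R) : `|u| < x -> is_derive x 1 F (f x).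
  move=> ux.
  have x2 : 0 < x ^+ 2 - u ^+ 2.
    by rewrite subr_gt0 -(real_normK (num_real u)) ltrXn2r ?nnegrE ?normr_ge0 ?(ltW (le_lt_trans _ ux)).
  have D2 := is_derive1D (is_derive1X 2 (is_derive_id x 1)) (is_derive1N (is_derive_cst (u ^+ 2) x 1)).
  have H := is_derive1Z w (@is_derive_sqrtX m (fun s : R => s ^+ 2 - u ^+ 2) x _ x2 D2).
  by apply: (@is_derive_eq _ _ _ _ _ _ _ _ H); rewrite /f /=; field.
have cF : continuous F by move=> x; apply: cvgM; [exact: cvg_cst|exact: csX].
rewrite (@continuous_FTC2 _ f F)//.
- rewrite -EFinB; congr EFin; rewrite /F real_normK ?num_real// subrr sqrtr0 expr0n/= mulr0 subr0.
  by rewrite pos_sqrtX_gt0.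
- exact: continuous_subspaceT.
- split.
  + by move=> x; rewrite in_itv/= => /andP[ux _]; have [] := DF _ ux.
  + exact/cvg_at_right_filter/cF.
  + exact/cvg_at_left_filter/cF.
- move=> x; rewrite in_itv/= => /andP[ux _]; rewrite derive1E.
  by have [] := DF _ ux.
Qed.

(** The sublevel set of the radius at level [s] is a ball of squared radius [s ^+ 2 - u ^+ 2] when
    [|u| < s] and is empty otherwise. The coordinate [u] is kept apart because the phase will depend
    on it. *)
Lemma ge0_integral_tuple_radial m : exists2 W : R, 0 < W &
  forall (u : R) (k : T -> \bar R), measurable_fun setT k -> (forall s, (0 <= k s)%E) ->
  (\int[L m.+2]_t k (Num.sqrt (u ^+ 2 + sqn t)) =
   \int[leb]_s (k s * (W * radial_density m u s)%:E))%E.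
Proof.
have [w w0 Lw] := @lebesgue_tuple_ball R m.+2.
exists (m.+2%:R * w) => [|u k mk k0]; first by rewrite mulr_gt0.
have muE s : L m.+2 [set t | Num.sqrt (u ^+ 2 + sqn t) < s] =
    (if `|u| < s then w * pos_sqrtX m.+2 (s ^+ 2 - u ^+ 2) else 0)%:E.
  have [us|us] := ltP.
    have s0 : 0 < s by exact: le_lt_trans us.
    have sE y : (Num.sqrt y < s) = (y < s ^+ 2).
      by rewrite -{1}[s]ger0_norm ?ltW// -sqrtr_sqr ltr_sqrt// exprn_gt0.
    by rewrite -Lw; congr (L _ _); apply/seteqP; split => t /=; rewrite sE ltrBrDl.
  rewrite (_ : [set t | _] = set0) ?measure0//; apply/seteqP; split => t //=.
  apply/negP; rewrite -leNgt (le_trans us)// -sqrtr_sqr ler_wsqrtr//.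
  by rewrite lerDl sqn_ge0.
apply: (@ge0_integral_pushforward_density _ _ _ _ (fun t => Num.sqrt (u ^+ 2 + sqn t))
  (fun s => m.+2%:R * w * radial_density m u s)) => //.
- apply: (measurableT_comp measurable_sqrt); apply: measurable_funD => //.
  exact: measurable_sqn.
- apply: measurable_funM => //.
  exact: (measurableT_comp (@measurable_radial_density m) (@measurable_pair1 _ _ _ _ u)).
- by move=> s; rewrite mulr_ge0 ?radial_density_ge0// mulr_ge0// ltW.
- by move=> s; apply: (etrans (muE s)); rewrite integral_radial_density.
- by move=> s; apply: (eq_ind_r (fun z => z < +oo)%E _ (muE s)); rewrite ltry.
Qed.

End radial_integral.

Section polar.
Context {R : realType}.
Local Notation T := (measurableTypeR R).
Local Notation leb := (@lebesgue_measure R).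
Local Notation L n := (lebesgue_tuple R n).
Local Open Scope ereal_scope.

Lemma radial_density_scale m (s t : R) : (0 < s)%R ->
  radial_density m (s * t) s = (s ^+ m.+1 * pos_sqrtX m (1 - t ^+ 2))%R.
Proof.
move=> s0; rewrite /radial_density max_l ?ltW// [X in _ = (X * _)%R]exprS -mulrA; congr (_ * _)%R.
have -> : (s ^+ 2 - (s * t) ^+ 2 = s ^+ 2 * (1 - t ^+ 2))%R by ring.
have [t1|t1] := leP (1 - t ^+ 2)%R 0%R.
  by rewrite !pos_sqrtX_le0 ?mulr0// mulr_ge0_le0// sqr_ge0.
have s2 : (0 < s ^+ 2)%R by rewrite exprn_gt0.
rewrite !pos_sqrtX_gt0 ?mulr_gt0// sqrtrM ?ltW// sqrtr_sqr gtr0_norm//.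
by rewrite exprMn.
Qed.

(** No measure on the sphere is introduced. After rotating [x] onto the first axis, the variables
    are the first coordinate [u] and the full radius [s]; the substitution [u = s * t] then
    separates the radius from the cosine [t] of the polar angle. With [N = m + 3], the angular
    weight is [(1 - t^2)^((N-3)/2)]. *)
Lemma ge0_integral_tuple_polar m : exists2 W : R, (0 < W)%R &
  forall (H : T * T -> \bar R) (x : 'I_m.+3 -> R),
  measurable_fun setT H -> (forall z, 0 <= H z) ->
  \int[L m.+3]_t H (Num.sqrt (sqn t), tdot x t) =
  \int[leb]_(s in `]0%R, +oo[) ((W * s ^+ m.+2)%:E *
    \int[leb]_t (H (s, (Num.sqrt (\sum_(i < m.+3) x i ^+ 2) * (s * t))%R) *
                 (pos_sqrtX m (1 - t ^+ 2))%:E)).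
Proof.
have [W W0 HW] := @ge0_integral_tuple_radial R m.
exists W => // H x mH H0; set c := Num.sqrt _.
pose H' (z : T * T) := H (Num.sqrt z.1 : T, z.2).
have mH' : measurable_fun setT H'.
  by apply: measurable_pair_fun => //; exact: (measurableT_comp measurable_sqrt).
have rot := ge0_integral_tuple_rotation x mH' (fun z => H0 _).
apply: (etrans rot); rewrite -/c {rot}.
have mF : measurable_fun setT (fun t : m.+3.-tuple T => H' (sqn t, c * (thead t : R))%R).
  apply: measurable_pair_fun => //; first exact: measurable_sqn.
  by apply: measurable_funM => //; exact: measurable_thead.
apply: (etrans (ge0_integral_lebesgue_tupleS mF (fun t => H0 _))).
pose K (z : T * T) := H (z.2, (c * z.1)%R) * (W * radial_density m z.1 z.2)%:E.
have mK : measurable_fun setT K.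
  apply: emeasurable_funM.
    by apply: measurable_pair_fun => //; exact: measurable_funM.
  apply/measurable_EFinP; apply: measurable_funM => //; exact: measurable_radial_density.
have K0 z : 0 <= K z.
  by rewrite mule_ge0// lee_fin mulr_ge0 ?radial_density_ge0// ltW.
transitivity (\int[leb]_u \int[leb]_s K (u, s)).
  apply: eq_integral => u _; rewrite -HW//; last first.
    by apply: measurable_pair_fun => //=; exact: measurable_id.
  by apply: eq_integral => t _; rewrite /H' sqn_cons theadE.
apply: (etrans (@fubini_tonelli _ _ _ _ R leb leb K mK K0)).
rewrite [RHS]integral_mkcond; apply: eq_integral => s _.
rewrite patchE mem_setE in_itv/= andbT; case: ifPn => [s0|]; last first.
  rewrite -leNgt => s0; apply: integral0_eq => u _.
  by rewrite /K radial_density0 ?mulr0 ?mule0// (le_trans s0).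
have mKs : measurable_fun setT (fun u : T => K (u, s)).
  exact: (measurableT_comp mK (@measurable_pair2 _ _ _ _ s)).
apply: (etrans (ge0_integral_affine 0%R s0 mKs (fun u => K0 _))).
rewrite exprS mulrCA EFinM -muleA; congr (_ * _).
rewrite -ge0_integralZl//; last 3 first.
- apply: emeasurable_funM.
    apply: measurable_pair_fun => //.
    by apply: measurable_funM => //; exact: measurable_funM.
  apply/measurable_EFinP/(measurableT_comp (@measurable_pos_sqrtX R m)).
  by apply: measurable_funB => //; exact: measurable_funX.
- by move=> t _; rewrite mule_ge0// lee_fin pos_sqrtX_ge0.
- by rewrite lee_fin mulr_ge0 ?exprn_ge0// ltW.
apply: eq_integral => t _; rewrite /K /= addr0 radial_density_scale//.
by rewrite muleCA -EFinM mulrA.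
Qed.

End polar.

(** * The oscillating factor *)

Section bessel_arch.
Context {R : realType}.
Local Notation T := (measurableTypeR R).
Local Notation leb := (@lebesgue_measure R).
Variables (m : nat) (c : R).

Definition weight (n : nat) (t : R) : R := Num.sqrt (1 - t ^+ 2) ^+ n.

Lemma continuous_weight n : continuous (weight n).
Proof.
move=> x; apply: (@continuous_comp _ _ _ (fun x : R => Num.sqrt (1 - x ^+ 2))
    (fun y : R => y ^+ n)); last exact: exprn_continuous.
apply: (@continuous_comp _ _ _ (fun x : R => 1 - x ^+ 2)); last exact: sqrt_continuous.
by apply: cvgB; [exact: cvg_cst|exact: exprn_continuous].
Qed.

Lemma integrable_segment (f : R -> R) (a b : R) : continuous f ->
  leb.-integrable `[a, b] (EFin \o f).
Proof.
move=> cf; apply: continuous_compact_integrable; first exact: segment_compact.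
exact: continuous_subspaceT.
Qed.

(** A general pair [k], [k'] allows one proof for both derivatives, with cosine and then sine under
    the integral. On [[-1, 1]] the differentiated integrand is dominated by the constant [|c|]. *)
Lemma is_derive_trig_integral (k k' p : R -> R) (s : R) :
  (forall z : R, is_derive z 1 k (k' z)) -> continuous k' -> (forall z, `|k' z| <= 1) ->
  continuous p -> (forall t, -1 <= t <= 1 -> `|p t| <= 1) ->
  is_derive s 1 (fun x => \int[leb]_(t in `[-1, 1]) (k (c * (x * t)) * p t))%R
    (\int[leb]_(t in `[-1, 1]) (c * t * k' (c * (s * t)) * p t))%R.
Proof.
move=> dk ck' k'1 cp p1.
pose f (x t : R) := k (c * (x * t)) * p t.
have ck : continuous k.
  by move=> z; apply/differentiable_continuous/derivable1_diffP; have [] := dk z.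
have cf x : continuous (f x).
  move=> t; apply: cvgM; last exact: cp.
  apply: (@continuous_comp _ _ _ (fun t : R => c * (x * t)) k); last exact: ck.
  by apply: cvgM; [exact: cvg_cst|apply: cvgM; [exact: cvg_cst|exact: cvg_id]].
have Df (x t : R) : is_derive x 1 (f ^~ t) (c * t * k' (c * (x * t)) * p t).
  have D1 : is_derive x 1 (fun x => c * (x * t)) (c * t).
    have := is_derive1Z c (is_derive1M (is_derive_id x 1) (is_derive_cst t x 1)).
    by rewrite mulr0 addr0 mul1r.
  have H := is_derive1M (is_derive1_chain D1 (dk (c * (x * t)))) (is_derive_cst (p t) x 1).
  by apply: (@is_derive_eq _ _ _ _ _ _ _ _ H); rewrite mulr0 addr0 /= [k' _ * _]mulrC.
have sI : s \in `](s - 1), (s + 1)[ by rewrite in_itv/=; apply/andP; split; lra.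
have intf x : `](s - 1), (s + 1)[%classic x -> leb.-integrable `[-1, 1] (EFin \o f x).
  by move=> _; exact: integrable_segment.
have derf x t : `](s - 1), (s + 1)[%classic x -> `[-1, 1]%classic t -> derivable (f ^~ t) x 1.
  by move=> _ _; have [] := Df x t.
have intG : leb.-integrable `[-1, 1] (EFin \o (fun _ : R => `|c|)).
  by apply: integrable_segment => x; exact: cvg_cst.
have dE x t : partial1of2 f x t = c * t * k' (c * (x * t)) * p t.
  by rewrite partial1of2E; have [] := Df x t.
have Gub x t : `](s - 1), (s + 1)[%classic x -> `[-1, 1]%classic t -> `|partial1of2 f x t| <= `|c|.
  move=> _ /=; rewrite in_itv/= => t1; rewrite dE !normrM -!mulrA ler_piMr//.
  have t1' : `|t| <= 1 by rewrite ler_norml.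
  apply: mulr_ile1 => //.
  by apply: mulr_ile1 => //; exact: p1.
have mB : measurable (`[-1, 1]%classic : set T) by exact: measurable_itv.
have := @differentiation_under_integral R _ T leb f `[-1, 1]%classic mB s (s - 1) (s + 1) sI
  intf derf (fun _ => `|c|) (fun _ => normr_ge0 c) intG Gub.
have := @derivable_under_integral R _ T leb f `[-1, 1]%classic mB s (s - 1) (s + 1) sI
  intf derf (fun _ => `|c|) (fun _ => normr_ge0 c) intG Gub.
move=> dF FE; split => //; rewrite -derive1E FE.
by apply: eq_Rintegral => t _; rewrite dE.
Qed.

(** Poisson's integral: for [c * s > 0] it is a constant multiple of [(c s)^(-nu) J_nu(c s)] with
    [nu = (n + 1) / 2]. *)
Definition cos_integral (n : nat) (s : R) : R :=
  (\int[leb]_(t in `[-1, 1]) (cos (c * (s * t)) * weight n t))%R.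

Lemma normr_weight_le1 n t : `|weight n t| <= 1.
Proof.
rewrite ger0_norm ?exprn_ge0 ?sqrtr_ge0// exprn_ile1 ?sqrtr_ge0//.
by rewrite -[leRHS]sqrtr1 ler_wsqrtr// lerBlDr lerDl sqr_ge0.
Qed.

Lemma is_derive_weight n (t : R) : -1 < t < 1 ->
  is_derive t 1 (fun t => - weight n.+2 t / n.+2%:R) (t * weight n t).
Proof.
move=> /andP[t1 t2].
have t0 : 0 < 1 - t ^+ 2 by nra.
have D1 := is_derive1D (is_derive_cst (1 : R) t 1) (is_derive1N (is_derive1X 2 (is_derive_id t 1))).
have D2 := @is_derive_sqrtX R n (fun t : R => 1 - t ^+ 2) t _ t0 D1.
have D3 := is_derive1M (is_derive1N D2) (is_derive_cst (n.+2%:R^-1 : R) t 1).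
apply: (@is_derive_eq _ _ _ _ _ _ _ _ D3); rewrite mulr0 addr0 /cst /weight /=.
have : (n.+2%:R : R) != 0 by rewrite pnatr_eq0.
by move: (n.+2%:R : R) => N N0; field.
Qed.

(** [t * weight n t] is the derivative of [- weight n.+2 t / n.+2%:R], which vanishes at both
    endpoints, so there is no boundary term and the index rises by two. *)
Lemma sin_integral_by_parts n (s : R) :
  (\int[leb]_(t in `[-1, 1]) (sin (c * (s * t)) * (t * weight n t)) =
   c * s / n.+2%:R * cos_integral n.+2 s)%R.
Proof.
pose F (t : R) := sin (c * (s * t)).
pose f (t : R) := c * s * cos (c * (s * t)).
pose G (t : R) := - weight n.+2 t / n.+2%:R.
pose g (t : R) := t * weight n t.
have cl : continuous (fun t : R => c * (s * t)).
  by move=> t; apply: cvgM; [exact: cvg_cst|apply: cvgM; [exact: cvg_cst|exact: cvg_id]].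
have ccos : continuous (fun t : R => cos (c * (s * t))).
  by move=> t; apply: (@continuous_comp _ _ _ (fun t : R => c * (s * t)) cos); [exact: cl|exact: continuous_cos].
have cF : continuous F.
  by move=> t; apply: (@continuous_comp _ _ _ (fun t : R => c * (s * t)) sin); [exact: cl|exact: continuous_sin].
have cf : continuous f by move=> t; apply: cvgM; [exact: cvg_cst|exact: ccos].
have cG : continuous G.
  by move=> t; apply: cvgM; [apply: cvgN; exact: continuous_weight|exact: cvg_cst].
have cg : continuous g by move=> t; apply: cvgM; [exact: cvg_id|exact: continuous_weight].
have DF (t : R) : is_derive t 1 F (f t).
  have D1 : is_derive t 1 (fun t => c * (s * t)) (c * s).
    by have := is_derive1Z c (is_derive1_scale t s).
  have H := is_derive1_chain D1 (is_derive_sin (c * (s * t))).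
  by apply: (@is_derive_eq _ _ _ _ _ _ _ _ H); rewrite mulrC.
have lt11 : (-1 : R) < 1 by lra.
have dFLR : derivable_oo_LRcontinuous F (-1) 1.
  split; [by move=> t _; have [] := DF t|exact/cvg_at_right_filter/cF|exact/cvg_at_left_filter/cF].
have dGLR : derivable_oo_LRcontinuous G (-1) 1.
  split; [|exact/cvg_at_right_filter/cG|exact/cvg_at_left_filter/cG].
  by move=> t; rewrite in_itv/= => /(is_derive_weight n)[].
have F'f : {in `]-1, 1[, derive1 F =1 f} by move=> t _; rewrite derive1E; have [] := DF t.
have G'g : {in `]-1, 1[, derive1 G =1 g}.
  by move=> t; rewrite in_itv/= derive1E => /(is_derive_weight n)[].
rewrite (Rintegration_by_parts lt11 (continuous_subspaceT cf) dFLR F'f (continuous_subspaceT cg) dGLR G'g).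
have -> : G 1 = 0 by rewrite /G /weight expr1n subrr sqrtr0 expr0n/= oppr0 mul0r.
have -> : G (-1) = 0 by rewrite /G /weight sqrrN expr1n subrr sqrtr0 expr0n/= oppr0 mul0r.
rewrite !mulr0 subrr sub0r /cos_integral -RintegralZl//; last first.
  by apply: integrable_segment => t; apply: cvgM; [exact: ccos|exact: continuous_weight].
rewrite -[LHS]mulN1r -RintegralZl//; last first.
  by apply: integrable_segment => t; apply: cvgM; [exact: cf|exact: cG].
by apply: eq_Rintegral => t _; rewrite /f /G; ring.
Qed.

Lemma is_derive_cos_integral n (s : R) :
  is_derive s 1 (cos_integral n) (- (c ^+ 2 * s / n.+2%:R * cos_integral n.+2 s)).
Proof.
have sN z : `|- sin z| <= (1 : R) by rewrite normrN ler_norml sin_geN1 sin_le1.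
have cNsin : continuous (fun z : R => - sin z) by move=> z; apply: cvgN; exact: continuous_sin.
have H := @is_derive_trig_integral cos (fun z => - sin z) (weight n) s (@is_derive_cos R)
  cNsin sN (@continuous_weight n) (fun t _ => normr_weight_le1 n t).
apply: (@is_derive_eq _ _ _ _ _ _ _ _ H).
transitivity (- c * (\int[leb]_(t in `[-1, 1]) (sin (c * (s * t)) * (t * weight n t)))%R).
  rewrite -RintegralZl//; last first.
    apply: integrable_segment => t; apply: cvgM.
      apply: (@continuous_comp _ _ _ (fun t : R => c * (s * t)) sin); last exact: continuous_sin.
      by apply: cvgM; [exact: cvg_cst|apply: cvgM; [exact: cvg_cst|exact: cvg_id]].
    by apply: cvgM; [exact: cvg_id|exact: continuous_weight].
  by apply: eq_Rintegral => t _; ring.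
by rewrite sin_integral_by_parts; ring.
Qed.

(** Applying the first-derivative formula again would bring in index [n.+4]. Returning to the sine
    form, the second derivative carries [t ^+ 2 * weight n t], which on [[-1, 1]] is
    [weight n t - weight n.+2 t]; the system closes on the indices [n] and [n.+2]. *)
Lemma is_derive2_cos_integral n (s : R) :
  is_derive s 1 (fun s => - (c ^+ 2 * s / n.+2%:R * cos_integral n.+2 s))
   (c ^+ 2 * (cos_integral n.+2 s - cos_integral n s)).
Proof.
have sN z : `|cos z| <= (1 : R) by rewrite ler_norml cos_geN1 cos_le1.
have cp : continuous (fun t : R => - (t * weight n t)).
  by move=> t; apply: cvgN; apply: cvgM; [exact: cvg_id|exact: continuous_weight].
have H := is_derive1Z c (@is_derive_trig_integral sin cos (fun t => - (t * weight n t)) s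
  (@is_derive_sin R) (@continuous_cos R) sN cp _).
have icos (p : R -> R) : continuous p ->
    leb.-integrable `[-1, 1] (EFin \o (fun t => cos (c * (s * t)) * p t)).
  move=> cp'; apply: integrable_segment => t; apply: cvgM; last exact: cp'.
  apply: (@continuous_comp _ _ _ (fun t : R => c * (s * t)) cos); last exact: continuous_cos.
  by apply: cvgM; [exact: cvg_cst|apply: cvgM; [exact: cvg_cst|exact: cvg_id]].
rewrite (_ : (fun s => _) = (fun s => c *
    (\int[leb]_(t in `[-1, 1]) (sin (c * (s * t)) * (- (t * weight n t))))%R)); last first.
  apply/funext => x.
  rewrite (_ : - (c ^+ 2 * x / n.+2%:R * cos_integral n.+2 x) =
    c * (-1 * (c * x / n.+2%:R * cos_integral n.+2 x))); last by ring.
  congr (c * _); rewrite -sin_integral_by_parts -RintegralZl//; last first.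
    apply: integrable_segment => t; apply: cvgM.
      apply: (@continuous_comp _ _ _ (fun t : R => c * (x * t)) sin); last exact: continuous_sin.
      by apply: cvgM; [exact: cvg_cst|apply: cvgM; [exact: cvg_cst|exact: cvg_id]].
    by apply: cvgM; [exact: cvg_id|exact: continuous_weight].
  by apply: eq_Rintegral => t _; ring.
have p1 t : -1 <= t <= 1 -> `|- (t * weight n t)| <= 1.
  by move=> t1; rewrite normrN normrM mulr_ile1 ?normr_weight_le1// ler_norml.
apply: (@is_derive_eq _ _ _ _ _ _ _ _ (H p1)).
rewrite expr2 -mulrA; congr (_ * _); rewrite /cos_integral -RintegralB//; [|by apply: icos; exact: continuous_weight..].
rewrite -RintegralZl//; last first.
  apply: (@integrable_segment (fun t => cos (c * (s * t)) * weight n.+2 t - cos (c * (s * t)) * weight n t)) => t.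
  have cc : {for t, continuous (fun t : R => cos (c * (s * t)))}.
    apply: (@continuous_comp _ _ _ (fun t : R => c * (s * t)) cos); last exact: continuous_cos.
    by apply: cvgM; [exact: cvg_cst|apply: cvgM; [exact: cvg_cst|exact: cvg_id]].
  by apply: cvgB; (apply: cvgM; [exact: cc|exact: continuous_weight]).
apply: eq_Rintegral => t; rewrite inE/= in_itv/= => /andP[t1 t2].
have -> : weight n.+2 t = (1 - t ^+ 2) * weight n t.
  by rewrite /weight -[n.+2]addn2 exprD sqr_sqrtr; [rewrite mulrC|nra].
by ring.
Qed.

Lemma continuous_cos_integral n : continuous (cos_integral n).
Proof.
move=> s; apply/differentiable_continuous/derivable1_diffP.
by have [] := is_derive_cos_integral n s.
Qed.

Lemma integral_weight_gt0 n : (0 < \int[leb]_(t in `[-1, 1]) weight n t)%R.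
Proof.
have [I I0 IE] := @integral_pos_sqrtX R n.
suff -> : (\int[leb]_(t in `[-1, 1]) weight n t)%R = I by [].
rewrite /Rintegral (_ : (\int[leb]_(t in `[(-1)%R, 1%R]) (weight n t)%:E)%E = I%:E)//.
have mw : measurable_fun setT (fun t : T => (weight n t)%:E).
  apply/measurable_EFinP; apply: continuous_measurable_fun; exact: continuous_weight.
rewrite -integral_itv_bndo_bndc; last exact: measurable_funTS.
rewrite -integral_itv_obnd_cbnd; last exact: measurable_funTS.
rewrite -IE integral_mkcond; apply: eq_integral => t _; rewrite patchE mem_setE in_itv/=.
case: ifPn => [/andP[t1 t2]|]; first by rewrite pos_sqrtX_gt0//; nra.
rewrite negb_and -!leNgt => t1; rewrite pos_sqrtX_le0//.
by move/orP : t1 => [] t1; nra.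
Qed.

(* Up to a constant, [sqrt s * J (c * s)] for the Bessel function [J] of order
   [(m + 1) / 2]. *)
Definition arch (s : R) : R := Num.sqrt s ^+ m.+2 * cos_integral m s.

Lemma continuous_arch : continuous arch.
Proof.
move=> s; apply: cvgM; last exact: continuous_cos_integral.
exact: (@continuous_comp _ _ _ (@Num.sqrt R) (fun y : R => y ^+ m.+2) s
  (@sqrt_continuous R s) (@exprn_continuous R _ _)).
Qed.

Lemma arch_gt0_near0 : exists2 e, 0 < e & forall s, 0 < s < e -> 0 < arch s.
Proof.
have A0 : 0 < cos_integral m 0.
  rewrite /cos_integral; under eq_Rintegral do rewrite mul0r mulr0 cos0 mul1r.
  exact: integral_weight_gt0.
have [e /= e0 He] := cvgr_gt _ (@continuous_cos_integral m 0) _ A0.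
exists e => // s /andP[s0 se]; rewrite mulr_gt0 ?exprn_gt0 ?sqrtr_gt0//.
by apply: He; rewrite /ball_/= sub0r normrN gtr0_norm.
Qed.

Lemma is_derive_sqrt_exp n (s : R) : 0 < s ->
  is_derive s 1 (fun s => Num.sqrt s ^+ n) (n%:R / 2 * Num.sqrt s ^+ n / s).
Proof.
move=> s0; have r0 : Num.sqrt s != 0 by rewrite gt_eqF// sqrtr_gt0.
have H := is_derive1X n (is_derive1_sqrt s0).
apply: (@is_derive_eq _ _ _ _ _ _ _ _ H).
case: n {H} => [|n]; first by rewrite !mul0r.
rewrite -[X in _ = _ / X](sqr_sqrtr (ltW s0)) /= exprS.
by move: (n.+1%:R : R) => N; field.
Qed.

Lemma arch_integral_ge0 (z : R) : 0 <= z -> (0 <= \int[leb]_(s in `[0, z]) arch s)%R.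
Proof.
move=> z0.
(* This is [(N - 1) / 2] for [N = m + 3], and [a * (a - 1)] is the constant [kappa]; [a >= 1] is
   what makes [q] nondecreasing. *)
pose a : R := m.+2%:R / 2.
have a1 : 1 <= a by rewrite /a ler_pdivlMr// mul1r ler_nat.
pose A := cos_integral m.
pose A' (s : R) := - (c ^+ 2 * s / m.+2%:R * cos_integral m.+2 s).
pose A'' (s : R) := c ^+ 2 * (cos_integral m.+2 s - A s).
pose r (s : R) := Num.sqrt s ^+ m.+2.
pose v (s : R) := a * r s / s * A s + r s * A' s.
pose q (s : R) := c ^+ 2 - a * (a - 1) / s ^+ 2.
have DA (s : R) : is_derive s 1 A (A' s) by exact: is_derive_cos_integral.
have DA' (s : R) : is_derive s 1 A' (A'' s) by exact: is_derive2_cos_integral.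
have Dr (s : R) : 0 < s -> is_derive s 1 r (a * r s / s) by move=> /(is_derive_sqrt_exp m.+2).
have du (s : R) : 0 < s -> is_derive s 1 arch (v s).
  by move=> s0; exact: (is_derive1M (Dr _ s0) (DA s)).
(* The equation [s A'' + 2 a A' + c^2 s A = 0]. Multiplying the solution by [s^a], which is [r],
   removes the first-order term. *)
have bessel (s : R) : s * A'' s = - (c ^+ 2) * s * A s - 2 * a * A' s.
  rewrite /A'' /A' /a; have : (m.+2%:R : R) != 0 by rewrite pnatr_eq0.
  by move: (m.+2%:R : R) => N N0; field.
have dv (s : R) : 0 < s -> is_derive s 1 v (- q s * arch s).
  move=> s0; have sN0 : s != 0 by rewrite gt_eqF.
  have D1 := is_derive1M (is_derive1M (is_derive1Z a (Dr _ s0)) (is_derive1V sN0 (is_derive_id s 1))) (DA s).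
  have D2 := is_derive1M (Dr _ s0) (DA' s).
  apply: (@is_derive_eq _ _ _ _ _ _ _ _ (is_derive1D D1 D2)).
  have -> : A'' s = - (c ^+ 2) * A s - 2 * a * A' s / s.
    by apply: (mulfI sN0); rewrite bessel; field.
  rewrite /q /arch -/(r s) -/(A s) /=.
  by field.
have qnd (s t : R) : 0 < s -> s <= t -> q s <= q t.
  have aa : 0 <= a * (a - 1) by nra.
  move=> s0 st; rewrite lerD2l lerN2 ler_wpM2l//.
  rewrite lef_pV2 ?posrE ?exprn_gt0//; last exact: lt_le_trans st.
  by rewrite lerXn2r// nnegrE ltW// (lt_le_trans s0).
have u0 : arch 0 = 0 by rewrite /arch sqrtr0 expr0n/= mul0r.
pose U (z : R) := (\int[leb]_(s in `[0, z]) arch s)%R.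
have iu a' b' : leb.-integrable `[a', b'] (EFin \o arch).
  by apply: integrable_segment; exact: continuous_arch.
apply: (@sturm_integral_ge0 R arch v q du dv qnd continuous_arch u0 U) => //.
- move=> s s0; have ss1 : s < s + 1 by rewrite ltrDl.
  have [dU UE] := continuous_FTC1_closed ss1 (iu 0 (s + 1)) s0 (@continuous_arch s).
  by split; rewrite -?derive1E.
- by rewrite /U set_itv1 Rintegral_set1.
- move=> Z; have [Z0|Z0] := leP 0 Z.
    exact: (parameterized_integral_continuous Z0 (iu 0 Z)).
  by rewrite set_itv_ge ?bnd_simp -?ltNge//; exact: continuous_subspace0.
- exact: arch_gt0_near0.
Qed.

End bessel_arch.

(** * Integration against decreasing weights *)

Section layer_cake.
Context {R : realType}.
Local Notation T := (measurableTypeR R).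
Local Notation leb := (@lebesgue_measure R).

(** Such a set is []0, S[] or []0, S]] with [S] its supremum. Endpoints are null, so two inclusions
    give the equality without deciding which case holds. *)
Lemma integral_downset (E : set T) (M : R) : measurable E ->
  (forall s, E s -> 0 < s <= M) -> (forall s t, E t -> 0 < s <= t -> E s) ->
  exists2 S : R, 0 <= S & forall b : T -> \bar R, measurable_fun setT b ->
    (forall s, (0 <= b s)%E) ->
    (\int[leb]_(s in E) b s = \int[leb]_(s in `[0%R, S]) b s)%E.
Proof.
move=> mE EM Edown.
have [E0|/set0P[e0 Ee0]] := eqVneq E set0.
  by exists 0 => // b mb b0; rewrite E0 integral_set0 set_itv1 integral_set1.
have hsE : has_sup E.
  by split; [exists e0|exists M => s /EM /andP[]].
have S0 : 0 <= sup E.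
  by apply: ltW; apply: lt_le_trans (ub_le_sup hsE.2 Ee0); have /andP[] := EM _ Ee0.
exists (sup E) => // b mb b0.
apply/eqP; rewrite eq_le; apply/andP; split.
  apply: ge0_subset_integral => //; first exact: measurable_funTS.
  move=> s Es /=; rewrite in_itv/= ub_le_sup//; last exact: hsE.2.
  by have /andP[/ltW ->] := EM _ Es.
rewrite -integral_itv_bndo_bndc; last exact: measurable_funTS.
rewrite -integral_itv_obnd_cbnd; last exact: measurable_funTS.
apply: ge0_subset_integral => //; first exact: measurable_funTS.
move=> s /=; rewrite in_itv/= => /andP[s0 sS].
have [t Et st] := sup_gt hsE.1 sS.
by apply: (Edown _ _ Et); rewrite s0 ltW.
Qed.

Lemma ge0_integral_indic_lt (a : R) : 0 <= a ->
  (\int[leb]_y (\1_(`]0, a[%classic : set T) y)%:E = a%:E)%E.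
Proof.
move=> a0; rewrite integral_indic// setIT; apply: (etrans (lebesgue_measure_itv `]0, a[)).
by rewrite /= lte_fin; case: ltgtP a0 => // [_ _|<- //]; rewrite oppr0 adde0.
Qed.

(** The value [0] at nonpositive levels lets the integral over levels run over the whole line. *)
Definition superlevel_integral (h b : T -> R) (y : R) : \bar R :=
  if 0 < y then (\int[leb]_(s in [set s : T | (0 < s)%R /\ (y < h s)%R]) (b s)%:E)%E else 0%E.

Lemma layer_cake_integral (h b : T -> R) :
  measurable_fun setT h -> (forall s, 0 < s -> 0 <= h s) ->
  measurable_fun setT b -> (forall s, 0 <= b s) ->
  measurable_fun setT (superlevel_integral h b : T -> \bar R) /\
  (\int[leb]_(s in `]0%R, +oo[) (h s * b s)%:E = \int[leb]_y superlevel_integral h b y)%E.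
Proof.
move=> mh h0 mb b0.
(* The indicator of [0 < s], [0 < y < h s], written as a product of one-dimensional indicators to
   make its measurability immediate. Integrating it in [y] returns [h s], and Tonelli does the
   rest. *)
pose chi (z : T * T) : R := \1_(`]0, +oo[%classic : set T) z.1 * \1_(`]0, +oo[%classic : set T) z.2
  * \1_(`]0, +oo[%classic : set T) (h z.1 - z.2).
have mI : measurable_fun setT (\1_(`]0, +oo[%classic : set T) : T -> R) by exact: measurable_indic.
have mchi : measurable_fun setT chi.
  apply: measurable_funM; first apply: measurable_funM.
  - exact: (measurableT_comp mI measurable_fst).
  - exact: (measurableT_comp mI measurable_snd).
  - apply: (measurableT_comp mI); apply: measurable_funB => //.
    exact: (measurableT_comp mh measurable_fst).
have chiE s y : chi (s, y) = if (0 < s) && ((0 < y) && (y < h s)) then 1 else 0.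
  rewrite /chi !indicE !mem_setE !in_itv/= !andbT subr_gt0.
  by case: (0 < s); case: (0 < y); case: (y < h s); rewrite ?mulr1 ?mulr0 ?mul0r.
pose K (z : T * T) := (chi z * b z.1)%:E.
have mK : measurable_fun setT K.
  apply/measurable_EFinP; apply: measurable_funM => //.
  exact: (measurableT_comp mb measurable_fst).
have K0 z : (0 <= K z)%E.
  case: z => s y; rewrite lee_fin mulr_ge0// chiE.
  by case: ifP.
have KE : (fun y : T => \int[leb]_s K (s, y))%E = superlevel_integral h b.
  apply/funext => y; rewrite /superlevel_integral; case: ifPn => [y0|]; last first.
    rewrite -leNgt => y0.
    by apply: integral0_eq => s _; rewrite /K chiE (ltNge 0 y) y0 /= andbF mul0r.
  rewrite [RHS]integral_mkcond; apply: eq_integral => s _; rewrite patchE /K chiE y0 /=.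
  case: ifPn => [/andP[s0 yh]|n].
    by rewrite mem_set//= mul1r.
  rewrite memNset/= ?mul0r// => -[s0 yh].
  by rewrite s0 yh in n.
rewrite -KE; split; first exact: (@measurable_fun_fubini_tonelli_G _ _ _ _ R leb K mK K0).
rewrite -(@fubini_tonelli _ _ _ _ R leb leb K mK K0).
rewrite integral_mkcond; apply: eq_integral => s _; rewrite patchE mem_setE in_itv/= andbT.
have [s0|s0] := ltP 0 s; last first.
  by apply/esym/integral0_eq => y _; rewrite /K chiE ltNge s0 /= mul0r.
rewrite mulrC EFinM -{1}(ge0_integral_indic_lt (h0 _ s0)) -ge0_integralZl//; last 2 first.
- by apply/measurable_EFinP; exact: measurable_indic.
- by rewrite lee_fin.
apply: eq_integral => y _; rewrite /K chiE s0 /= indicE mem_setE in_itv/= -EFinM mulrC.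
by case: ifP.
Qed.

(** Monotonicity makes every superlevel set of [h] an initial interval of the positive axis, and
    decay at infinity makes it bounded; the assumed inequality on [[0, z]] then applies level by
    level. [h] need not be bounded near [0]. *)
Lemma nonincreasing_integral_le (h b b' : T -> R) :
  measurable_fun setT h -> (forall s, 0 < s -> 0 <= h s) ->
  (forall s t, 0 < s -> s <= t -> h t <= h s) ->
  (forall y, 0 < y -> exists M : R, forall s, M < s -> h s <= y) ->
  measurable_fun setT b -> (forall s, 0 <= b s) ->
  measurable_fun setT b' -> (forall s, 0 <= b' s) ->
  (forall z : R, 0 <= z -> (\int[leb]_(s in `[0%R, z]) (b s)%:E <=
     \int[leb]_(s in `[0%R, z]) (b' s)%:E)%E) ->
  (\int[leb]_(s in `]0%R, +oo[) (h s * b s)%:E <=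
   \int[leb]_(s in `]0%R, +oo[) (h s * b' s)%:E)%E.
Proof.
move=> mh h0 hd hoo mb b0 mb' b0' bb'.
have mI : measurable_fun setT (\1_(`]0, +oo[%classic : set T) : T -> R) by exact: measurable_indic.
have mE : forall y : R, measurable [set s : T | 0 < s /\ y < h s].
  move=> y.
  have := measurableI _ _ (measurable_itv `]0, +oo[ : measurable (_ : set T))
    (mh measurableT _ (measurable_itv `]y, +oo[)).
  by congr measurable; apply/seteqP; split => s /=; rewrite !in_itv/= !andbT; [move=> [? [_]]|move=> []].
have [mg ->] := layer_cake_integral mh h0 mb b0.
have [mg' ->] := layer_cake_integral mh h0 mb' b0'.
apply: ge0_le_integral => //.
  move=> y _; rewrite /superlevel_integral; case: ifP => // _.
  by apply: integral_ge0 => s _; rewrite lee_fin.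
move=> y _; rewrite /superlevel_integral; case: ifP => // y0.
have [M hM] := hoo _ y0.
have [|s t|S S0 SE] := @integral_downset [set s : T | 0 < s /\ y < h s] M (mE y).
- by move=> s /= [s0 ys]; rewrite s0 /= leNgt; apply/negP => /hM; rewrite leNgt ys.
- by move=> /= [t0 yt] /andP[s0 st]; split => //; exact: (lt_le_trans yt (hd _ _ s0 st)).
rewrite !SE//; try by [exact/measurable_EFinP|move=> s; rewrite lee_fin].
exact: bb'.
Qed.

(** Adding [b] turns the sign of the integral of [h * u] into a comparison of nonnegative integrals.
    Finiteness is required of the smaller one only. *)
Lemma nonincreasing_integral_lt (h b u : R -> R) (e : R) :
  measurable_fun setT (h : T -> R) -> (forall s, 0 < s -> 0 <= h s) ->
  (forall s t, 0 < s -> s < t -> h t < h s) ->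
  (forall y, 0 < y -> exists M : R, forall s, M < s -> h s <= y) ->
  continuous b -> (forall s, 0 <= b s) ->
  continuous u -> (forall s, 0 <= b s + u s) ->
  (forall z, 0 <= z -> 0 <= \int[leb]_(s in `[0, z]) u s)%R ->
  0 < e -> (forall s, 0 < s < e -> 0 < u s) ->
  (\int[leb]_(s in `]0%R, +oo[) (h s * b s)%:E < +oo)%E ->
  (\int[leb]_(s in `]0%R, +oo[) (h s * b s)%:E <
   \int[leb]_(s in `]0%R, +oo[) (h s * (b s + u s))%:E)%E.
Proof.
move=> mh h0 hd hoo cb b0 cu bu0 U0 e0 ue hb.
have mb : measurable_fun setT (b : T -> R) by exact: continuous_measurable_fun.
have cbu : continuous (fun s => b s + u s) by move=> s; apply: cvgD; [exact: cb|exact: cu].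
have mbu : measurable_fun setT ((fun s => b s + u s) : T -> R) by exact: continuous_measurable_fun.
pose s1 := e / 2.
have s10 : 0 < s1 by rewrite divr_gt0.
have s1e : s1 < e by rewrite /s1; lra.
pose h1 s := Num.min (h s) (h s1).
pose h2 s := Num.max (h s - h s1) 0.
have h12 s : h s = h1 s + h2 s.
  by rewrite /h1 /h2; case: (leP (h s) (h s1)) => H; [rewrite max_r|rewrite max_l]; lra.
have mh1 : measurable_fun setT (h1 : T -> R) by exact: measurable_minr.
have mh2 : measurable_fun setT (h2 : T -> R).
  by apply: measurable_maxr => //; exact: measurable_funB.
have h10 s : 0 < s -> 0 <= h1 s by move=> s0; rewrite le_min !h0.
have h20 s : 0 <= h2 s by rewrite le_max lexx orbT.
have hle s t : 0 < s -> s <= t -> h t <= h s.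
  by move=> s0; rewrite le_eqVlt => /predU1P[->//|st]; rewrite ltW// hd.
(* [h1] is nonincreasing, which gives the weak inequality; [h2] is positive on
   [0 < s < s1] only, where [u > 0], which gives strictness. *)
have split_int (g : R -> R) : measurable_fun setT (g : T -> R) -> (forall s, 0 <= g s) ->
    (\int[leb]_(s in `]0%R, +oo[) (h s * g s)%:E =
     \int[leb]_(s in `]0%R, +oo[) (h1 s * g s)%:E + \int[leb]_(s in `]0%R, +oo[) (h2 s * g s)%:E)%E.
  move=> mg g0; rewrite -ge0_integralD//.
  - by apply: eq_integral => s _; rewrite -EFinD -mulrDl -h12.
  - by move=> s /=; rewrite in_itv/= andbT => s0; rewrite lee_fin mulr_ge0// h10.
  - by apply/measurable_funTS/measurable_EFinP; exact: measurable_funM.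
  - by move=> s _; rewrite lee_fin mulr_ge0.
  - by apply/measurable_funTS/measurable_EFinP; exact: measurable_funM.
have le1 : (\int[leb]_(s in `]0%R, +oo[) (h1 s * b s)%:E <=
    \int[leb]_(s in `]0%R, +oo[) (h1 s * (b s + u s))%:E)%E.
  apply: (@nonincreasing_integral_le h1 b (fun s => b s + u s)) => //.
  - move=> s t s0 st; rewrite le_min !ge_min lexx orbT andbT.
    by rewrite hle.
  - by move=> y /hoo[M HM]; exists M => s /HM hy; rewrite ge_min hy.
  - move=> z z0.
    have ib := integrable_segment 0 z cb; have iu := integrable_segment 0 z cu.
    under [leRHS]eq_integral do rewrite EFinD.
    rewrite integralD//= leeDl//.
    have := U0 _ z0; rewrite /Rintegral -lee_fin fineK//.
    exact: integrable_fin_num.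
have [d d0 lt2] : exists2 d : R, 0 < d & (\int[leb]_(s in `]0%R, +oo[) (h2 s * b s)%:E + d%:E <=
    \int[leb]_(s in `]0%R, +oo[) (h2 s * (b s + u s))%:E)%E.
  have s1I : s1 / 4 <= s1 / 2 by lra.
  have [p + umin] := EVT_min s1I (continuous_subspaceT cu).
  rewrite in_itv/= => /andP[p1 p2].
  have up : 0 < u p by apply: ue; apply/andP; split; lra.
  have k0 : 0 < h (s1 / 2) - h s1 by rewrite subr_gt0 hd//; lra.
  (* On [[s1 / 4, s1 / 2]], of length [s1 / 4], [h2] is at least [h (s1 / 2) - h s1] by monotonicity
     and [u] is at least its minimum [u p]. *)
  pose d := (h (s1 / 2) - h s1) * u p.
  have d0 : 0 < d by rewrite mulr_gt0.
  exists (d * (s1 / 4)); first by rewrite mulr_gt0// divr_gt0.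
  pose J : set T := `[(s1 / 4), (s1 / 2)]%classic.
  have mJ : measurable J by exact: (measurable_itv `[(s1 / 4), (s1 / 2)]).
  have -> : (d * (s1 / 4))%:E = (\int[leb]_(s in `]0%R, +oo[) (d * \1_J s)%:E)%E.
    under eq_integral do rewrite EFinM.
    rewrite ge0_integralZl//; last 2 first.
    - by apply/measurable_EFinP; exact: measurable_indic.
    - by rewrite lee_fin ltW.
    rewrite integral_indic// setIidl; last first.
      by move=> s; rewrite /J /= !in_itv/= andbT => /andP[+ _]; apply: lt_le_trans; lra.
    rewrite EFinM; congr (_ * _)%E; apply/esym/(etrans (lebesgue_measure_itv `[(s1 / 4), (s1 / 2)])).
    have s12 : s1 / 4 < s1 / 2 by lra.
    by rewrite /= lte_fin s12 -EFinB; congr EFin; field.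
  have dJ0 s : 0 <= d * \1_J s by rewrite mulr_ge0 ?(ltW d0)// indicE.
  have mdJ : measurable_fun setT ((fun s => d * \1_J s) : T -> R).
    by apply: measurable_funM => //; exact: measurable_indic.
  rewrite -ge0_integralD//; last 4 first.
  - by move=> s _; rewrite lee_fin mulr_ge0.
  - by apply/measurable_funTS/measurable_EFinP; exact: measurable_funM.
  - by move=> s _; rewrite lee_fin.
  - by apply/measurable_funTS/measurable_EFinP.
  apply: ge0_le_integral => //.
  - by move=> s _; rewrite -EFinD lee_fin addr_ge0// mulr_ge0.
  - apply/measurable_funTS/measurable_EFinP; apply: measurable_funD => //.
    exact: measurable_funM.
  - by apply/measurable_funTS/measurable_EFinP; exact: measurable_funM.
  - move=> s /=; rewrite in_itv/= andbT => s0; rewrite -EFinD lee_fin mulrDr lerD2l.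
    rewrite indicE /J mem_setE in_itv/=; have [/andP[sa sb]|_] := boolP (_ && _); last first.
      rewrite mulr0; have [ss1|ss1] := ltP s s1.
        by rewrite mulr_ge0// ltW// ue// s0 (lt_trans ss1).
      by rewrite /h2 max_r ?mul0r// subr_le0 hle.
    rewrite mulr1 /d; apply: ler_pM; rewrite ?(ltW k0) ?(ltW up)//.
      by rewrite le_max lerD2r hle.
    by apply: umin; rewrite in_itv/= sa.
rewrite !split_int// in hb *.
move: hb le1 lt2.
have : (0 <= \int[leb]_(s in `]0%R, +oo[) (h1 s * b s)%:E)%E.
  by apply: integral_ge0 => s /=; rewrite in_itv/= andbT => s0; rewrite lee_fin mulr_ge0// h10.
have : (0 <= \int[leb]_(s in `]0%R, +oo[) (h2 s * b s)%:E)%E.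
  by apply: integral_ge0 => s _; rewrite lee_fin mulr_ge0.
move: (\int[leb]_(s in _) (h1 s * b s)%:E)%E (\int[leb]_(s in _) (h2 s * b s)%:E)%E => A1 A2.
move: (\int[leb]_(s in _) (h1 s * _)%:E)%E (\int[leb]_(s in _) (h2 s * _)%:E)%E => B1 B2.
(* The hypothesis on [h * b] makes both summands [A1] and [A2] real, so adding [d] is a strict
   increase; [B1] and [B2] may still be infinite. *)
case: A1 => [A1| |]; case: A2 => [A2| |] // _ _ _ AB1 AB2.
apply: (@lt_le_trans _ _ (A1%:E + (A2%:E + d%:E))%E); last exact: leeD.
by rewrite -!EFinD lte_fin addrA ltrDl.
Qed.

End layer_cake.

(** * Gaussian-type Schwartz functions *)

Section schwartz_gaussian.
Context (R : realType) (N : nat).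
Local Notation V := ('rV[R]_N).
Local Notation e_ i := (delta_mx ord0 i : V).

(** Polynomial functions are generated inductively rather than taken from formal polynomials, so
    that closure under partial derivatives and polynomial growth are direct inductions. *)
Inductive polynomial_fun : (V -> R) -> Prop :=
| polynomial_cst c : polynomial_fun (fun _ => c)
| polynomial_coord i : polynomial_fun (fun x => x ord0 i)
| polynomial_add P Q : polynomial_fun P -> polynomial_fun Q -> polynomial_fun (fun x => P x + Q x)
| polynomial_mul P Q : polynomial_fun P -> polynomial_fun Q -> polynomial_fun (fun x => P x * Q x).

Lemma derive_coord (x v : V) (j : 'I_N) : 'D_v (fun y : V => y ord0 j : R^o) x = v ord0 j.
Proof.
have H : derivable (id : V -> V) x v by exact: derivable_id.
have := derive_mx H.
by rewrite derive_id => /matrixP/(_ ord0 j); rewrite mxE.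
Qed.

Lemma derive_mul (f g : V -> R^o) (x v : V) : differentiable f x -> differentiable g x ->
  'D_v (fun y => f y * g y : R^o) x = 'D_v f x * g x + f x * 'D_v g x.
Proof.
move=> df dg.
have := deriveM (diff_derivable (v := v) df) (diff_derivable (v := v) dg).
by rewrite /GRing.scale /= => E; apply: (etrans E); ring.
Qed.

Lemma derive_add (f g : V -> R^o) (x v : V) : differentiable f x -> differentiable g x ->
  'D_v (fun y => f y + g y : R^o) x = 'D_v f x + 'D_v g x.
Proof.
by move=> df dg; exact: (deriveD (diff_derivable (v := v) df) (diff_derivable (v := v) dg)).
Qed.

Lemma differentiable_chain (f : V -> R^o) (g : R -> R) (x : V) (dg : R) :
  differentiable f x -> is_derive (f x) 1 g dg -> differentiable (fun y => g (f y) : R^o) x.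
Proof.
by move=> df [Dg _]; apply: differentiable_comp => //; exact/derivable1_diffP.
Qed.

Lemma derive_chain (f : V -> R^o) (g : R -> R) (x v : V) (dg : R) :
  differentiable f x -> is_derive (f x) 1 g dg ->
  'D_v (fun y => g (f y) : R^o) x = dg * 'D_v f x.
Proof.
move=> df Hg; have [/derivable1_diffP Dg gE] := Hg.
have dc := differentiable_chain df Hg.
rewrite (deriveE v dc) (deriveE v df).
have := diff_comp df Dg => /(congr1 (fun h : V -> R^o => h v)) E.
apply: (etrans E) => /=.
by rewrite (diff1E Dg) derive1E gE /GRing.scale /= mulrC.
Qed.

Lemma polynomial_differentiable P : polynomial_fun P ->
  forall x : V, differentiable (P : V -> R^o) x.
Proof.
elim=> [c|i|{}P Q _ dP _ dQ|{}P Q _ dP _ dQ] x.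
- exact: differentiable_cst.
- exact: differentiable_coord.
- exact: differentiableD.
- exact: differentiableM.
Qed.

Lemma polynomial_partial P i : polynomial_fun P ->
  exists2 P', polynomial_fun P' & forall x : V, 'D_(e_ i) (P : V -> R^o) x = P' x.
Proof.
elim=> [c|j|{}P Q pP [P' pP' eP] pQ [Q' pQ' eQ]|{}P Q pP [P' pP' eP] pQ [Q' pQ' eQ]].
- by exists (fun _ => 0); [exact: polynomial_cst|move=> x; exact: derive_cst].
- exists (fun _ => e_ i ord0 j); [exact: polynomial_cst|move=> x; exact: derive_coord].
- exists (fun x => P' x + Q' x); first exact: polynomial_add.
  by move=> x; rewrite derive_add ?eP ?eQ//; exact: polynomial_differentiable.
- exists (fun x => P' x * Q x + P x * Q' x).
    by apply: polynomial_add; apply: polynomial_mul.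
  by move=> x; rewrite derive_mul ?eP ?eQ//; exact: polynomial_differentiable.
Qed.

Lemma dotp_ge0 (x : V) : 0 <= dotp x x.
Proof. by apply: sumr_ge0 => i _; rewrite -expr2 sqr_ge0. Qed.

Lemma polynomial_growth P : polynomial_fun P ->
  exists C : R, exists k : nat, 0 <= C /\ forall x : V, `|P x| <= C * (1 + dotp x x) ^+ k.
Proof.
have d1 (x : V) : 1 <= 1 + dotp x x by rewrite lerDl dotp_ge0.
elim=> [c|i|{}P Q _ [C [k [C0 HP]]] _ [D [l [D0 HQ]]]|{}P Q _ [C [k [C0 HP]]] _ [D [l [D0 HQ]]]].
- by exists `|c|, 0%N; split => // x; rewrite expr0 mulr1.
- exists 1, 1%N; split => // x; rewrite mul1r expr1.
  have H : x ord0 i ^+ 2 <= dotp x x.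
    rewrite /dotp (bigD1 i)//= -expr2 lerDl.
    by apply: sumr_ge0 => j _; rewrite -expr2 sqr_ge0.
  rewrite -real_normK ?num_real// in H.
  by have := normr_ge0 (x ord0 i); nra.
- exists (C + D), (k + l)%N; split => [|x]; first exact: addr_ge0.
  apply: (le_trans (ler_normD _ _)); rewrite mulrDl; apply: lerD.
    by apply: (le_trans (HP x)); rewrite ler_wpM2l// ler_weXn2l// leq_addr.
  by apply: (le_trans (HQ x)); rewrite ler_wpM2l// ler_weXn2l// leq_addl.
- exists (C * D), (k + l)%N; split => [|x]; first exact: mulr_ge0.
  by rewrite normrM exprD mulrACA ler_pM.
Qed.

(** Here [r] stands for the squared norm. With [y = tau * r ^+ 2], the bound [1 + r <= A * (1 + y)]
    reduces to powers of [1 + y], and [1 + y <= k' * expR (y / k')] raised to the power [k'] costs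
    exactly one [expR y]. Using [k.+1] for [k'] avoids dividing by zero. *)
Lemma exp_quartic_bound (tau : R) (k : nat) : 0 < tau ->
  exists M : R, forall r : R, 0 <= r -> (1 + r) ^+ k * expR (- tau * r ^+ 2) <= M.
Proof.
move=> t0; pose A := 2 + tau^-1; pose k' : R := k.+1%:R.
have A0 : 0 <= A by rewrite addr_ge0// invr_ge0 ltW.
have k1 : 1 <= k' by rewrite ler1n.
exists ((A * k') ^+ k.+1) => r r0; pose y := tau * r ^+ 2.
have y0 : 0 <= y by rewrite mulr_ge0 ?sqr_ge0// ltW.
have ry : 1 + r <= A * (1 + y).
  have -> : A * (1 + y) = 2 + 2 * y + tau^-1 + r ^+ 2.
    by rewrite /A /y; field; rewrite gt_eqF.
  have : 0 < tau^-1 by rewrite invr_gt0.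
  by nra.
have yk : 1 + y <= k' * expR (y / k').
  apply: (@le_trans _ _ (k' * (1 + y / k'))).
    by rewrite mulrDr mulr1 mulrCA divff ?mulr1 ?lerD2r// gt_eqF// (lt_le_trans _ k1).
  by rewrite ler_wpM2l ?expR_ge1Dx// (le_trans _ k1).
have H : (1 + r) ^+ k <= (A * k') ^+ k.+1 * expR y.
  apply: (@le_trans _ _ ((1 + r) ^+ k.+1)); first by rewrite ler_weXn2l// lerDl.
  have -> : expR y = expR (y / k') ^+ k.+1.
    by rewrite -expRM_natl mulrC divfK// gt_eqF// (lt_le_trans _ k1).
  rewrite -exprMn lerXn2r ?nnegrE ?addr_ge0 ?mulr_ge0 ?expR_ge0 ?(le_trans _ k1)//.
  by rewrite -mulrA (le_trans ry)// ler_wpM2l.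
rewrite mulNr expRN -/y -ler_pdivlMr ?invr_gt0 ?expR_gt0// invrK.
exact: H.
Qed.

Section gaussian_class.
Variables (tau : R) (x : V).
Hypothesis tau0 : 0 < tau.

Definition quartic (xi : V) : R := - tau * (dotp xi xi * dotp xi xi).

(** A real class containing both parts of the wave packet and stable under partial derivatives:
    differentiating only changes the polynomial coefficients of the cosine and the sine. All
    Schwartz bounds thus reduce to a single one. *)
Definition gaussian_fun (g : V -> R) : Prop := exists P Q, [/\ polynomial_fun P, polynomial_fun Q &
  forall xi, g xi = expR (quartic xi) * (P xi * cos (dotp x xi) + Q xi * sin (dotp x xi))].

Lemma polynomial_sum (I : Type) (s : seq I) (F : I -> V -> R) :
  (forall i, polynomial_fun (F i)) -> polynomial_fun (fun xi => \sum_(i <- s) F i xi).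
Proof.
move=> pF; elim: s => [|i s IH].
  by under [X in polynomial_fun X]eq_fun do rewrite big_nil; exact: polynomial_cst.
under [X in polynomial_fun X]eq_fun do rewrite big_cons.
exact: polynomial_add.
Qed.

Lemma polynomial_dotp : polynomial_fun (dotp x).
Proof.
apply: polynomial_sum => i; apply: polynomial_mul; [exact: polynomial_cst|exact: polynomial_coord].
Qed.

Lemma polynomial_quartic : polynomial_fun quartic.
Proof.
have pd : polynomial_fun (fun xi : V => dotp xi xi).
  by apply: polynomial_sum => i; apply: polynomial_mul; exact: polynomial_coord.
by apply: polynomial_mul; [exact: polynomial_cst|exact: polynomial_mul].
Qed.

Lemma gaussian_differentiable g : gaussian_fun g ->
  forall xi : V, differentiable (g : V -> R^o) xi.
Proof.
move=> [P [Q [pP pQ gE]]] xi.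
rewrite (_ : g = (fun xi => expR (quartic xi) * (P xi * cos (dotp x xi) + Q xi * sin (dotp x xi))));
  last exact/funext.
have Dl := polynomial_differentiable polynomial_dotp xi.
have Dq := polynomial_differentiable polynomial_quartic xi.
apply: differentiableM; first exact: (differentiable_chain Dq (is_derive_expR _)).
apply: differentiableD; apply: differentiableM.
- exact: polynomial_differentiable.
- exact: (differentiable_chain Dl (is_derive_cos _)).
- exact: polynomial_differentiable.
- exact: (differentiable_chain Dl (is_derive_sin _)).
Qed.

Lemma gaussian_partial g i : gaussian_fun g ->
  gaussian_fun (fun xi => 'D_(e_ i) (g : V -> R^o) xi).
Proof.
move=> [P [Q [pP pQ gE]]].
have -> : g = (fun xi => expR (quartic xi) * (P xi * cos (dotp x xi) + Q xi * sin (dotp x xi))).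
  exact/funext.
have [P' pP' eP] := polynomial_partial i pP.
have [Q' pQ' eQ] := polynomial_partial i pQ.
have [l' pl' el] := polynomial_partial i polynomial_dotp.
have [q' pq' eq] := polynomial_partial i polynomial_quartic.
exists (fun xi => (q' xi * P xi + P' xi) + l' xi * Q xi).
exists (fun xi => (q' xi * Q xi + Q' xi) + (-1) * (l' xi * P xi)).
split.
- by do !(apply: polynomial_add || apply: polynomial_mul || assumption || exact: polynomial_cst).
- by do !(apply: polynomial_add || apply: polynomial_mul || assumption || exact: polynomial_cst).
- move=> xi.
  have Dl := polynomial_differentiable polynomial_dotp xi.
  have Dq := polynomial_differentiable polynomial_quartic xi.
  have DP := polynomial_differentiable pP xi.
  have DQ := polynomial_differentiable pQ xi.
  have De := differentiable_chain Dq (is_derive_expR _).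
  have Dc := differentiable_chain Dl (is_derive_cos _).
  have Ds := differentiable_chain Dl (is_derive_sin _).
  have DPc : differentiable (fun xi => P xi * cos (dotp x xi) : R^o) xi by exact: differentiableM.
  have DQs : differentiable (fun xi => Q xi * sin (dotp x xi) : R^o) xi by exact: differentiableM.
  have DPQ : differentiable (fun xi => P xi * cos (dotp x xi) + Q xi * sin (dotp x xi) : R^o) xi.
    exact: differentiableD.
  rewrite (derive_mul _ De DPQ) (derive_add _ DPc DQs) (derive_mul _ DP Dc) (derive_mul _ DQ Ds).
  rewrite (derive_chain _ Dq (is_derive_expR _)) (derive_chain _ Dl (is_derive_cos _)).
  rewrite (derive_chain _ Dl (is_derive_sin _)) eP eQ el eq.
  ring.
Qed.

Lemma gaussian_bounded g a : gaussian_fun g ->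
  exists M : R, forall xi, `|monomial a xi * g xi| <= M.
Proof.
move=> [P [Q [pP pQ gE]]].
have pm : polynomial_fun (monomial a).
  rewrite /monomial; elim: a => [|i a IH].
    by under [X in polynomial_fun X]eq_fun do rewrite big_nil; exact: polynomial_cst.
  under [X in polynomial_fun X]eq_fun do rewrite big_cons.
  by apply: polynomial_mul => //; exact: polynomial_coord.
have [C [k [C0 HP]]] := polynomial_growth (polynomial_mul pm pP).
have [D [l [D0 HQ]]] := polynomial_growth (polynomial_mul pm pQ).
have [M1 HM1] := exp_quartic_bound k tau0.
have [M2 HM2] := exp_quartic_bound l tau0.
exists (C * M1 + D * M2) => xi; set r := dotp xi xi.
have aux (y z K : R) : `|y| <= K -> `|z| <= 1 ->
    `|expR (quartic xi) * (y * z)| <= K * expR (quartic xi).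
  move=> yK z1; rewrite normrM (ger0_norm (expR_ge0 _)) mulrC ler_wpM2r ?expR_ge0//.
  by rewrite normrM (le_trans _ yK)// ler_piMr.
have -> : monomial a xi * g xi = expR (quartic xi) * (monomial a xi * P xi * cos (dotp x xi)) +
    expR (quartic xi) * (monomial a xi * Q xi * sin (dotp x xi)) by rewrite gE; ring.
apply: (le_trans (ler_normD _ _)); apply: lerD.
- apply: (le_trans (aux _ _ _ (HP xi) _)); first by rewrite ler_norml cos_geN1 cos_le1.
  by rewrite -mulrA ler_wpM2l// HM1// dotp_ge0.
- apply: (le_trans (aux _ _ _ (HQ xi) _)); first by rewrite ler_norml sin_geN1 sin_le1.
  by rewrite -mulrA ler_wpM2l// HM2// dotp_ge0.
Qed.

Lemma partials_gaussian (f : V -> R[i]) (b : seq 'I_N) :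
  gaussian_fun (fun xi => complex.Re (f xi)) -> gaussian_fun (fun xi => complex.Im (f xi)) ->
  gaussian_fun (fun xi => complex.Re (partials b f xi)) /\
  gaussian_fun (fun xi => complex.Im (partials b f xi)).
Proof.
move=> gr gi; elim: b => [//|i b [IHr IHi]].
by split; apply: gaussian_partial.
Qed.

Lemma schwartz_gaussian (f : V -> R[i]) :
  gaussian_fun (fun xi => complex.Re (f xi)) -> gaussian_fun (fun xi => complex.Im (f xi)) ->
  schwartz f.
Proof.
move=> gr gi; split.
  move=> b xi; have [pr pi] := partials_gaussian b gr gi.
  by split; exact: gaussian_differentiable.
move=> a b; have [pr pi] := partials_gaussian b gr gi.
have [M1 HM1] := gaussian_bounded a pr.
have [M2 HM2] := gaussian_bounded a pi.
exists (M1 + M2) => xi; have := HM1 xi; have := HM2 xi.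
case: (partials b f xi) => u v /=; rewrite !mul0r subr0 addr0 => H2 H1.
rewrite -[leRHS]ger0_norm ?addr_ge0 ?(le_trans _ H1) ?(le_trans _ H2)// -sqrtr_sqr ler_wsqrtr//.
have := ler_norm (monomial a xi * u); have := ler_norm (monomial a xi * v).
rewrite -(real_normK (num_real (_ * u))) -(real_normK (num_real (_ * v))).
have := normr_ge0 (monomial a xi * u); have := normr_ge0 (monomial a xi * v).
nra.
Qed.

Lemma schwartz_wave_packet (c : R) :
  schwartz (fun xi => c%:C * (expi (dotp x xi) * exp_quartic tau xi)).
Proof.
have qE xi : - tau * enorm xi ^+ 4 = quartic xi.
  rewrite /quartic /enorm (_ : 4 = 2 * 2)%N// exprM sqr_sqrtr ?dotp_ge0//.
apply: schwartz_gaussian.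
- exists (fun _ => c), (fun _ => 0); split; [exact: polynomial_cst..|move=> xi /=].
  by rewrite qE; ring.
- exists (fun _ => 0), (fun _ => c); split; [exact: polynomial_cst..|move=> xi /=].
  by rewrite qE; ring.
Qed.

End gaussian_class.

End schwartz_gaussian.

(** * The semigroup as a Fourier integral *)

Section transfer.
Context (R : realType) (N : nat).
Local Notation V := ('rV[R]_N).
Local Notation T := (measurableTypeR R).
Local Notation L n := (lebesgue_tuple R n).

Definition coords (x : V) (i : 'I_N) : R := x ord0 i.

Lemma dotp_vec_of (x : V) t : dotp x (vec_of t) = tdot (coords x) t.
Proof. by apply: eq_bigr => i _; rewrite mxE. Qed.

Lemma enorm_vec_of t : enorm (vec_of t : V) = Num.sqrt (sqn t).
Proof. by rewrite /enorm; congr Num.sqrt; apply: eq_bigr => i _; rewrite mxE expr2. Qed.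

Lemma expiD (a b : R) : expi (a + b) = expi a * expi b.
Proof. by rewrite /expi cosD sinD; apply/eqP; rewrite eq_complex /= eqxx/= addrC. Qed.

Lemma exp_quarticD (s t : R) (xi : V) : exp_quartic s xi * exp_quartic t xi = exp_quartic (s + t) xi.
Proof.
by rewrite /exp_quartic -rmorphM/= -expRD; congr ((expR _)%:C); ring.
Qed.

Lemma dotpC (x y : V) : dotp x y = dotp y x.
Proof. by apply: eq_bigr => i _; rewrite mulrC. Qed.

Lemma dotpBl (x y z : V) : dotp (x - y) z = dotp x z - dotp y z.
Proof. by rewrite /dotp -sumrB; apply: eq_bigr => i _; rewrite !mxE mulrBl. Qed.

(** No integrability is assumed: a positive factor commutes with the extended integral also when it
    is infinite, and [fine] then sends both sides to [0]. *)
Lemma Rintegral_pscale d (X : measurableType d) (mu : {measure set X -> \bar R}) (c : R) (f : X -> R) :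
  0 < c -> measurable_fun setT f ->
  Rintegral mu setT (fun x => c * f x) = c * Rintegral mu setT f.
Proof.
move=> c0 mf; rewrite /Rintegral.
have mE : measurable_fun setT (EFin \o f) by exact/measurable_EFinP.
have -> : (\int[mu]_x (c * f x)%:E = c%:E * \int[mu]_x (f x)%:E)%E.
  rewrite integralE [in RHS]integralE.
  have -> : (fun x => (c * f x)%:E)^\+%E = (fun x => c%:E * (EFin \o f)^\+ x)%E.
    by rewrite -(ge0_funeposM _ (ltW c0)); apply/funext => x.
  have -> : (fun x => (c * f x)%:E)^\-%E = (fun x => c%:E * (EFin \o f)^\- x)%E.
    by rewrite -(ge0_funenegM _ (ltW c0)); apply/funext => x.
  rewrite !ge0_integralZl//; try by [exact: measurable_funepos|exact: measurable_funeneg|rewrite lee_fin ltW].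
  have : (0 <= \int[mu]_x (EFin \o f)^\+ x)%E by exact: integral_ge0.
  have : (0 <= \int[mu]_x (EFin \o f)^\- x)%E by exact: integral_ge0.
  move: (\int[mu]_x (EFin \o f)^\+ x)%E (\int[mu]_x (EFin \o f)^\- x)%E => a b.
  have cy : (c%:E * +oo = +oo)%E by rewrite gt0_muley// lte_fin.
  have cNy : (c%:E * -oo = -oo)%E by rewrite gt0_muleNy// lte_fin.
  case: a b => [a| |] [b| |] // _ _.
  - by rewrite -!EFinM -!EFinB mulrBr.
  - by rewrite cy -EFinM /= cNy.
  - by rewrite cy -EFinM.
  - by rewrite cy /= cNy.
case: (\int[mu]_x (f x)%:E)%E => [a//| |] /=.
  by rewrite gt0_muley ?lte_fin//= mulr0.
by rewrite gt0_muleNy ?lte_fin//= mulr0.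
Qed.

Lemma integralC_pscale (c : R) (G : V -> R[i]) : 0 < c ->
  measurable_fun setT (fun t : N.-tuple T => complex.Re (G (vec_of t))) ->
  measurable_fun setT (fun t : N.-tuple T => complex.Im (G (vec_of t))) ->
  integralC (fun xi => c%:C * G xi) = c%:C * integralC G.
Proof.
move=> c0 mr mi; rewrite /integralC.
have rE z : complex.Re (c%:C * z) = c * complex.Re z by case: z => a b /=; rewrite mul0r subr0.
have iE z : complex.Im (c%:C * z) = c * complex.Im z by case: z => a b /=; rewrite mul0r addr0.
apply/eqP; rewrite eq_complex /= !mul0r subr0 addr0.
rewrite -!Rintegral_pscale//; apply/andP; split; apply/eqP; congr Rintegral; apply/funext => t.
- by rewrite rE.
- by rewrite iE.
Qed.

End transfer.

(** * Fourier integral of a radial function: sine part and cosine part *)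

Section radial_cosine.
Context (R : realType) (m : nat).
Local Notation T := (measurableTypeR R).
Local Notation leb := (@lebesgue_measure R).
Local Notation L n := (lebesgue_tuple R n).
Variables (G : R -> R) (x : 'I_m.+3 -> R).
Hypotheses (mG : measurable_fun setT (G : T -> R)) (G0 : forall s, 0 <= G s).

Let c := Num.sqrt (\sum_(i < m.+3) x i ^+ 2).

Lemma measurable_radial : measurable_fun setT (fun t : m.+3.-tuple T => G (Num.sqrt (sqn t)) : R).
Proof.
apply: (measurableT_comp mG); apply: (measurableT_comp measurable_sqrt).
exact: measurable_sqn.
Qed.

(** The positive part of the integrand is [H] evaluated with [x], and the negative part is the same
    [H] with [- x]. The polar formula sees [x] only through its norm, so the two integrals
    coincide. *)
Lemma radial_sin_integral0 :
  Rintegral (L m.+3) setT (fun t => G (Num.sqrt (sqn t)) * sin (tdot x t)) = 0.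
Proof.
pose H (z : T * T) := (G z.1 * Num.max (sin z.2) 0)%:E.
have mH : measurable_fun setT H.
  apply/measurable_EFinP; apply: measurable_funM; first exact: (measurableT_comp mG measurable_fst).
  apply: measurable_maxr => //; apply: (measurableT_comp _ measurable_snd).
  by apply: continuous_measurable_fun; exact: continuous_sin.
have H0 z : (0 <= H z)%E by rewrite lee_fin mulr_ge0// le_max lexx orbT.
have [W W0 HW] := @ge0_integral_tuple_polar R m.
have posE : (fun t => (G (Num.sqrt (sqn t)) * sin (tdot x t))%:E)^\+%E =
    (fun t : m.+3.-tuple T => H (Num.sqrt (sqn t), tdot x t)).
  apply/funext => t; rewrite funeposE /H /= -EFin_max; congr EFin.
  by rewrite maxr_pMr// mulr0.
have negE : (fun t => (G (Num.sqrt (sqn t)) * sin (tdot x t))%:E)^\-%E =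
    (fun t : m.+3.-tuple T => H (Num.sqrt (sqn t), tdot (fun i => - x i) t)).
  apply/funext => t; rewrite funenegE /H /= -EFin_max; congr EFin.
  have -> : tdot (fun i => - x i) t = - tdot x t.
    by rewrite /tdot -sumrN; apply: eq_bigr => i _; rewrite mulNr.
  by rewrite sinN -mulrN maxr_pMr// mulr0.
rewrite /Rintegral integralE posE negE !HW//.
have -> : \sum_(i < m.+3) (- x i) ^+ 2 = \sum_(i < m.+3) x i ^+ 2.
  by apply: eq_bigr => i _; rewrite sqrrN.
(* If the common value is infinite, the difference is infinite as well and [fine] returns [0]. *)
by case: (\int[_]_(_ in _) _)%E => [r| |]//=; rewrite ?subrr.
Qed.

Hypothesis Gdecr : forall s t, 0 < s -> s < t ->
  Num.sqrt t ^+ m.+2 * G t < Num.sqrt s ^+ m.+2 * G s.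
Hypothesis Goo : forall y, 0 < y -> exists M : R, forall s, M < s ->
  Num.sqrt s ^+ m.+2 * G s <= y.
Hypothesis Gfin : (\int[L m.+3]_t (G (Num.sqrt (sqn t)))%:E < +oo)%E.

Lemma radial_cos_integral_gt0 :
  0 < Rintegral (L m.+3) setT (fun t => G (Num.sqrt (sqn t)) * cos (tdot x t)).
Proof.
have [W W0 HW] := @ge0_integral_tuple_polar R m.
have [I I0 IE] := @integral_pos_sqrtX R m.
(* The Jacobian [s ^+ m.+2] is split into two equal factors: one goes to [h], the other to [b],
   which accounts for the constant [1] in [1 + cos], and to [u], which accounts for the cosine. *)
pose h (s : R) := W * (Num.sqrt s ^+ m.+2 * G s).
pose b (s : R) := Num.sqrt s ^+ m.+2 * I.
pose u := arch m c.
have msX : measurable_fun setT ((fun s => Num.sqrt s ^+ m.+2) : T -> R).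
  by apply: measurable_funX; exact: measurable_sqrt.
have mh : measurable_fun setT (h : T -> R).
  by apply: measurable_funM => //; exact: measurable_funM.
have h0 s : 0 < s -> 0 <= h s.
  by move=> s0; rewrite mulr_ge0 ?(ltW W0)// mulr_ge0// exprn_ge0// sqrtr_ge0.
have ss (s : R) : 0 < s -> s ^+ m.+2 = Num.sqrt s ^+ m.+2 * Num.sqrt s ^+ m.+2.
  by move=> s0; rewrite -exprMn -expr2 sqr_sqrtr// ltW.
have E1 : (\int[L m.+3]_t (G (Num.sqrt (sqn t)))%:E =
    \int[leb]_(s in `]0%R, +oo[) (h s * b s)%:E)%E.
  pose H (z : T * T) := (G z.1)%:E.
  have mH : measurable_fun setT H by apply/measurable_EFinP; exact: (measurableT_comp mG measurable_fst).
  rewrite (HW H x mH)//; last by move=> z; rewrite lee_fin.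
  apply: eq_integral => s; rewrite inE/= in_itv/= andbT => s0; rewrite /H /=.
  rewrite ge0_integralZl ?lee_fin//; last 2 first.
  - apply/measurable_EFinP/(measurableT_comp (@measurable_pos_sqrtX R m)).
    by apply: measurable_funB => //; exact: measurable_funX.
  - by move=> t _; rewrite lee_fin pos_sqrtX_ge0.
  by rewrite IE -!EFinM ss// /h /b; congr EFin; ring.
have wE (s : R) : (\int[leb]_t ((1 + cos (c * (s * t))) * pos_sqrtX m (1 - t ^+ 2))%:E =
    (I + cos_integral c m s)%:E)%E.
  have ccos : continuous (fun t : R => cos (c * (s * t))).
    move=> t; apply: (@continuous_comp _ _ _ (fun t : R => c * (s * t)) cos); last exact: continuous_cos.
    by apply: cvgM; [exact: cvg_cst|apply: cvgM; [exact: cvg_cst|exact: cvg_id]].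
  have ccw : continuous (fun t : R => cos (c * (s * t)) * weight m t).
    by move=> t; apply: cvgM; [exact: ccos|exact: continuous_weight].
  have cw : continuous (fun t : R => (1 + cos (c * (s * t))) * weight m t).
    by move=> t; apply: cvgM; [apply: cvgD; [exact: cvg_cst|exact: ccos]|exact: continuous_weight].
  (* [pos_sqrtX m (1 - t ^+ 2)] agrees with [weight m t] on []-1, 1[] and vanishes outside; the
     endpoints are null. *)
  have toseg (g : R -> R) : continuous g ->
      (\int[leb]_t (g t * pos_sqrtX m (1 - t ^+ 2))%:E =
       \int[leb]_(t in `[(-1)%R, 1%R]) (g t * weight m t)%:E)%E.
    move=> cg.
    have mgw : measurable_fun setT (fun t : T => (g t * weight m t)%:E).
      apply/measurable_EFinP; apply: continuous_measurable_fun => t.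
      by apply: cvgM; [exact: cg|exact: continuous_weight].
    rewrite -integral_itv_bndo_bndc; last exact: measurable_funTS.
    rewrite -integral_itv_obnd_cbnd; last exact: measurable_funTS.
    rewrite [RHS]integral_mkcond; apply: eq_integral => t _; rewrite patchE mem_setE in_itv/=.
    case: ifPn => [/andP[t1 t2]|]; first by rewrite pos_sqrtX_gt0//; nra.
    rewrite negb_and -!leNgt => t1; rewrite pos_sqrtX_le0 ?mulr0//.
    by move/orP : t1 => [] t1; nra.
  have IE' : (\int[leb]_(t in `[(-1)%R, 1%R]) (weight m t)%:E = I%:E)%E.
    rewrite -IE; under [RHS]eq_integral do rewrite -[pos_sqrtX _ _]mul1r.
    rewrite (toseg (fun _ => 1)); last by move=> t; exact: cvg_cst.
    by apply: eq_integral => t _; rewrite mul1r.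
  rewrite (toseg (fun t => 1 + cos (c * (s * t)))); last first.
    by move=> t; apply: cvgD; [exact: cvg_cst|exact: ccos].
  have iw := integrable_segment (-1) 1 (@continuous_weight R m).
  have icw := integrable_segment (-1) 1 ccw.
  under eq_integral do rewrite mulrDl mul1r EFinD.
  rewrite integralD//= IE' EFinD; congr (_ + _)%E.
  rewrite /cos_integral /Rintegral fineK//; exact: integrable_fin_num.
have E2 : (\int[L m.+3]_t (G (Num.sqrt (sqn t)) * (1 + cos (tdot x t)))%:E =
    \int[leb]_(s in `]0%R, +oo[) (h s * (b s + u s))%:E)%E.
  pose H (z : T * T) := (G z.1 * (1 + cos z.2))%:E.
  have mcos : measurable_fun setT (cos : T -> R).
    by apply: continuous_measurable_fun; exact: continuous_cos.
  have mH : measurable_fun setT H.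
    apply/measurable_EFinP; apply: measurable_funM; first exact: (measurableT_comp mG measurable_fst).
    by apply: measurable_funD => //; exact: (measurableT_comp mcos measurable_snd).
  have c10 (z : R) : 0 <= 1 + cos z by have := cos_geN1 z; lra.
  rewrite (HW H x mH)//; last by move=> z; rewrite lee_fin mulr_ge0.
  apply: eq_integral => s; rewrite inE/= in_itv/= andbT => s0; rewrite /H /=.
  transitivity ((W * s ^+ m.+2)%:E * \int[leb]_t ((G s)%:E *
      ((1 + cos (c * (s * t))) * pos_sqrtX m (1 - t ^+ 2))%:E))%E.
    congr (_ * _)%E; apply: eq_integral => t _. by rewrite -!EFinM; congr EFin; ring.
  rewrite ge0_integralZl ?lee_fin//; last 2 first.
  - apply/measurable_EFinP; apply: measurable_funM.
      apply: measurable_funD => //; apply: (measurableT_comp mcos).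
      by apply: measurable_funM => //; exact: measurable_funM.
    apply: (measurableT_comp (@measurable_pos_sqrtX R m)).
    by apply: measurable_funB => //; exact: measurable_funX.
  - by move=> t _; rewrite lee_fin mulr_ge0// pos_sqrtX_ge0.
  by rewrite wE -!EFinM ss// /h /b /u /arch; congr EFin; ring.
have [e e0 ue] := arch_gt0_near0 m c.
have lt12 : (\int[L m.+3]_t (G (Num.sqrt (sqn t)))%:E <
    \int[L m.+3]_t (G (Num.sqrt (sqn t)) * (1 + cos (tdot x t)))%:E)%E.
  rewrite E2 E1; apply: (@nonincreasing_integral_lt R h b u e) => //.
  - by move=> s t s0 st; rewrite ltr_pM2l// Gdecr.
  - move=> y y0; have yW : 0 < y / W by rewrite divr_gt0.
    have [M HM] := Goo yW.
    by exists M => s /HM; rewrite ler_pdivlMr// mulrC.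
  - move=> s; apply: cvgM; last exact: cvg_cst.
    exact: (@continuous_comp _ _ _ (@Num.sqrt R) (fun y : R => y ^+ m.+2) s
      (@sqrt_continuous R s) (@exprn_continuous R _ _)).
  - by move=> s; rewrite mulr_ge0 ?(ltW I0)// exprn_ge0// sqrtr_ge0.
  - exact: continuous_arch.
  - move=> s; rewrite /b /u /arch -mulrDr mulr_ge0 ?exprn_ge0 ?sqrtr_ge0//.
    by rewrite -lee_fin -wE; apply: integral_ge0 => t _; rewrite lee_fin mulr_ge0 ?pos_sqrtX_ge0//.
  - by move=> z z0; exact: arch_integral_ge0.
  - by rewrite -E1.
have mcost : measurable_fun setT (fun t : m.+3.-tuple T => cos (tdot x t) : R).
  apply: (@measurableT_comp _ _ _ _ T _ (cos : T -> R)).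
    by apply: continuous_measurable_fun; exact: continuous_cos.
  exact: measurable_tdot.
have iG : (L m.+3).-integrable setT (fun t => (G (Num.sqrt (sqn t)))%:E).
  apply/integrableP; split; first by apply/measurable_EFinP; exact: measurable_radial.
  by under eq_integral do rewrite gee0_abs ?lee_fin//.
have iGc : (L m.+3).-integrable setT (fun t => (G (Num.sqrt (sqn t)) * cos (tdot x t))%:E).
  apply: (le_integrable _ _ _ iG) => //.
    by apply/measurable_EFinP; apply: measurable_funM => //; exact: measurable_radial.
  move=> t _; rewrite /= lee_fin normrM ler_piMr// ler_norml.
  by rewrite cos_geN1 cos_le1.
(* The integral of [G] is finite, so it cancels from both sides and leaves the cosine integral. *)
move: lt12; under [X in (_ < X)%E]eq_integral do rewrite mulrDr mulr1 EFinD.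
rewrite integralD// lteDl//; last exact: integrable_fin_num.
have fc := integrable_fin_num measurableT iGc.
by rewrite /Rintegral -lte_fin fineK.
Qed.

End radial_cosine.

(** * From the radial profile to a measurable damped weight *)

Section profile.
Context (R : realType).
Local Notation T := (measurableTypeR R).
Local Notation leb := (@lebesgue_measure R).
Local Notation L n := (lebesgue_tuple R n).

Lemma lebesgue_tuple_origin n : L n.+1 [set t | forall i, [set 0 : R] (tnth t i)] = 0%E.
Proof.
rewrite (@tuple_measure_box _ _ _ leb n.+1 (fun _ => [set 0 : R])); last first.
  by move=> i; exact: measurable_set1.
by rewrite big_ord_recl [X in (X * _)%E]lebesgue_measure_set1 mul0e.
Qed.

(** The radial formula for the transform says nothing at the origin; this makes identities valid off
    the origin sufficient under the integral. *)
Lemma ae_eq_off_origin n (f g : n.+1.-tuple T -> \bar R) :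
  (forall t, 0 < sqn t -> f t = g t) -> ae_eq (L n.+1) setT f g.
Proof.
move=> fg; exists [set t | forall i, [set 0 : R] (tnth t i)]; split.
- rewrite (_ : [set t | _] = \bigcap_(i in [set: 'I_n.+1]) (fun t : n.+1.-tuple T => tnth t i) @^-1` [set 0 : R]).
    apply: fin_bigcap_measurable => // i _.
    rewrite -[X in measurable X]setTI; apply: measurable_tnth => //; exact: measurable_set1.
  by apply/seteqP; split => t /= h i; [move=> _|]; exact: h.
- exact: lebesgue_tuple_origin.
- move=> t /= nfg i; apply/eqP; apply: contra_notT nfg => ti _; apply: fg.
  rewrite /sqn (bigD1 i)//= ltr_wpDr//; last first.
    by rewrite lt_neqAle sqr_ge0 andbT eq_sym sqrf_eq0.
  by apply: sumr_ge0 => j _; exact: sqr_ge0.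
Qed.

(** Measurability comes from regularity: [f] is the quotient of the weighted profile, continuous
    because derivable, by a power that is continuous and nonzero on the open half-line. *)
Lemma measurable_profile (N : nat) (f : R -> R) :
  (forall s : R, 0 < s -> derivable (weighted_profile N f) s 1) ->
  measurable_fun (`]0, +oo[%classic : set T) (f : T -> T).
Proof.
move=> df.
pose p : R := (N%:R - 1) / 2.
pose k (s : R) := weighted_profile N f s / s `^ p.
apply: (@eq_measurable_fun _ _ _ _ _ (k : T -> T)).
  move=> s; rewrite inE/= in_itv/= andbT => s0.
  by rewrite /k /weighted_profile mulrC mulKf// gt_eqF// powR_gt0.
apply: open_continuous_measurable_fun; first exact: interval_open.
move=> s; rewrite inE/= in_itv/= andbT => s0; apply: cvgM.
  exact/differentiable_continuous/derivable1_diffP/df.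
apply: cvgV; first by rewrite gt_eqF// powR_gt0.
have [/derivable1_diffP/differentiable_continuous D _] := is_derive1_powR p s0.
exact: D.
Qed.

Lemma profile_nonincreasing (N : nat) (f : R -> R) :
  (forall s : R, 0 < s -> derivable (weighted_profile N f) s 1) ->
  (forall s : R, 0 < s -> derive1 (weighted_profile N f) s <= 0) ->
  forall s t : R, 0 < s -> s <= t -> weighted_profile N f t <= weighted_profile N f s.
Proof.
move=> df df0 s t s0 st.
have D (z : R) : s <= z <= t -> is_derive z 1 (weighted_profile N f) (derive1 (weighted_profile N f) z).
  by move=> /andP[sz _]; rewrite derive1E; apply: derivableP; apply: df; exact: lt_le_trans sz.
apply: (is_derive_le0_noninc st (is_derive_within D)).
- by move=> z /andP[/ltW sz /ltW zt]; apply: D; rewrite sz.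
- by move=> z /andP[sz _]; apply: df0; exact: lt_trans sz.
Qed.

(** The cut at [0] yields a function that is nonnegative and measurable on the whole line, whatever
    the values of [f] at nonpositive arguments. *)
Definition damped_profile (t : R) (f : R -> R) : R -> R :=
  (fun r => expR (- t * r ^+ 4) * f r) \_ `]0, +oo[.

Lemma damped_profileE t f r : 0 < r -> damped_profile t f r = expR (- t * r ^+ 4) * f r.
Proof. by move=> r0; rewrite /damped_profile patchE mem_set//= in_itv/= r0. Qed.

Lemma damped_profile_weighted m t f r : 0 < r ->
  Num.sqrt r ^+ m.+2 * damped_profile t f r =
  expR (- t * r ^+ 4) * weighted_profile m.+3 f r.
Proof.
move=> r0; rewrite damped_profileE// /weighted_profile mulrCA; congr (_ * (_ * _)).
rewrite -powR12_sqrt ?ltW// -powR_mulrn ?powR_ge0// -powRrM; congr (_ `^ _).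
by rewrite -[in RHS]natr1 addrK mulrC.
Qed.

End profile.

(** * The semigroup at time [tau + tau] *)

Section semigroup.
Context (R : realType).
Local Notation T := (measurableTypeR R).
Local Notation L n := (lebesgue_tuple R n).

Lemma measurable_wave_packet N (tau : R) (x : 'rV[R]_N) :
  measurable_fun setT (fun t : N.-tuple T =>
    complex.Re (expi (dotp x (vec_of t)) * exp_quartic tau (vec_of t))) /\
  measurable_fun setT (fun t : N.-tuple T =>
    complex.Im (expi (dotp x (vec_of t)) * exp_quartic tau (vec_of t))).
Proof.
have mq : measurable_fun setT (fun t : N.-tuple T => expR (- tau * Num.sqrt (sqn t) ^+ 4) : T).
  apply: (@measurableT_comp _ _ _ _ T _ (expR : T -> T)); first exact: measurable_expR.
  apply: measurable_funM => //; apply: measurable_funX.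
  exact: (measurableT_comp measurable_sqrt (@measurable_sqn _ _)).
split.
- rewrite (_ : (fun t => _) = (fun t : N.-tuple T =>
    cos (tdot (coords x) t) * expR (- tau * Num.sqrt (sqn t) ^+ 4))).
    apply: measurable_funM => //; apply: (@measurableT_comp _ _ _ _ T _ (cos : T -> T)).
      by apply: continuous_measurable_fun; exact: continuous_cos.
    exact: measurable_tdot.
  by apply/funext => t; rewrite /= mulr0 subr0 dotp_vec_of enorm_vec_of.
- rewrite (_ : (fun t => _) = (fun t : N.-tuple T =>
    sin (tdot (coords x) t) * expR (- tau * Num.sqrt (sqn t) ^+ 4))).
    apply: measurable_funM => //; apply: (@measurableT_comp _ _ _ _ T _ (sin : T -> T)).
      by apply: continuous_measurable_fun; exact: continuous_sin.
    exact: measurable_tdot.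
  by apply/funext => t; rewrite /= mulr0 add0r dotp_vec_of enorm_vec_of.
Qed.

Definition fourier_constant (N : nat) : R := (2 * pi) `^ (- (N%:R / 2)).

Lemma fourier_constant_gt0 N : 0 < fourier_constant N.
Proof. by rewrite powR_gt0// mulr_gt0// pi_gt0. Qed.

(** The phases combine into [expi (dotp (x - y) xi)]. The wave packet carries one factor
    [(2 pi)^(-N/2)] and the transform supplies another; their product is the [(2 pi)^(-N)] of the
    kernel. *)
Lemma fourier_wave_packet N (tau : R) (x : 'rV[R]_N) :
  fourier (fun xi => exp_quartic tau xi *
    ((fourier_constant N)%:C * (expi (dotp x xi) * exp_quartic tau xi))) =
  (fun y => biharmonic_kernel (tau + tau) (x - y)).
Proof.
apply/funext => y; rewrite /fourier /biharmonic_kernel -/(fourier_constant N).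
set c := fourier_constant N.
rewrite (_ : (fun xi => expi (- dotp xi y) * _) =
    (fun xi => c%:C * (expi (dotp (x - y) xi) * exp_quartic (tau + tau) xi))); last first.
  apply/funext => xi; rewrite -exp_quarticD dotpBl expiD (dotpC y xi); ring.
have [mr mi] := measurable_wave_packet (tau + tau) (x - y).
rewrite (integralC_pscale (fourier_constant_gt0 N) mr mi) mulrA -rmorphM /=; congr (_%:C * _).
have p0 : 0 < (2 * pi : R) by rewrite mulr_gt0// pi_gt0.
rewrite /c /fourier_constant -powRD; last by apply/implyP => _; rewrite gt_eqF.
by rewrite -powR_invn ?ltW// -opprD -splitr.
Qed.

Lemma biharmonic_semigroup_integral N (phi : functional R N) (Fphi : 'rV[R]_N -> R[i]) (tau : R) x :
  0 < tau ->
  is_L1_dist (mul_dist (exp_quartic tau) (fourier_dist phi))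
    (fun xi => exp_quartic tau xi * Fphi xi) ->
  biharmonic_semigroup phi (tau + tau) x =
  integralC (fun xi => exp_quartic tau xi * Fphi xi *
    ((fourier_constant N)%:C * (expi (dotp x xi) * exp_quartic tau xi))).
Proof.
move=> tau0 [_ /(_ _ (schwartz_wave_packet x tau0 (fourier_constant N))) <-].
by rewrite /mul_dist /fourier_dist fourier_wave_packet.
Qed.

End semigroup.

(** [Fphi] is the function representing the Fourier transform of [phi], and [f] is its radial
    profile; [is_L1_dist] expresses both this representation and condition (a). In [R[i]], [0 < z]
    means that the imaginary part of [z] is zero and its real part positive, so both parts are
    computed. *)
Theorem theorem1p1 (R : realType) (N : nat) (phi : functional R N)
    (Fphi : 'rV[R]_N -> R[i]) (f : R -> R) :
  (3 <= N)%N ->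
  tempered phi ->
  (forall t : R, 0 < t ->
     is_L1_dist (mul_dist (exp_quartic t) (fourier_dist phi))
                (fun xi => exp_quartic t xi * Fphi xi)) ->
  (forall xi : 'rV[R]_N, xi != 0 -> Fphi xi = (f (enorm xi))%:C) ->
  (forall s : R, 0 < s -> 0 < f s) ->
  (forall s : R, 0 < s -> derivable (weighted_profile N f) s 1) ->
  (forall s : R, 0 < s -> {for s, continuous (derive1 (weighted_profile N f))}) ->
  (forall s : R, 0 < s -> derive1 (weighted_profile N f) s <= 0) ->
  forall (x : 'rV[R]_N) (t : R), 0 < t -> 0 < biharmonic_semigroup phi t x.
Proof.
case: N phi Fphi => [|[|[|m]]] phi Fphi // _ _ hL1 hF f0 df _ df0 x t t0.
pose tau := t / 2.
have tau0 : 0 < tau by rewrite divr_gt0.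
have tE : t = tau + tau by rewrite /tau; field.
pose G := damped_profile t f.
have G0 s : 0 <= G s.
  rewrite /G /damped_profile patchE; case: ifPn => //; rewrite inE/= in_itv/= andbT => s0.
  by rewrite mulr_ge0 ?expR_ge0// ltW// f0.
have mG : measurable_fun setT (G : measurableTypeR R -> R).
  apply/(measurable_restrictT _ _).1; first exact: (measurable_itv `]0, +oo[).
  apply: measurable_funM; last exact: measurable_profile df.
  apply: measurable_funTS.
  apply: (@measurableT_comp _ _ _ _ (measurableTypeR R) _ (expR : measurableTypeR R -> R)).
    exact: measurable_expR.
  by apply: measurable_funM => //; exact: measurable_funX.
pose psi := weighted_profile m.+3 f.
have psi0 s : 0 < s -> 0 < psi s by move=> s0; rewrite mulr_gt0 ?f0// powR_gt0.
have psid := profile_nonincreasing df df0.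
(* [psi] is only nonincreasing; the strictness comes from the exponential. *)
have Gdecr s s' : 0 < s -> s < s' ->
    Num.sqrt s' ^+ m.+2 * G s' < Num.sqrt s ^+ m.+2 * G s.
  move=> s0 ss'; have s'0 := lt_trans s0 ss'.
  rewrite !damped_profile_weighted// -/psi.
  apply: (@le_lt_trans _ _ (expR (- t * s' ^+ 4) * psi s)).
    by rewrite ler_wpM2l ?expR_ge0// psid// ltW.
  by rewrite ltr_pM2r ?psi0// ltr_expR !mulNr ltrN2 ltr_pM2l// ltrXn2r// ltW.
have Goo y : 0 < y -> exists M : R, forall s, M < s -> Num.sqrt s ^+ m.+2 * G s <= y.
  (* Beyond [1], [psi] is at most [psi 1], and [expR (t * s ^+ 4) >= t * s ^+ 4 >= t * s]; the
     second bound on [s] makes [y * (t * s)] exceed [psi 1]. *)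
  move=> y0; exists (Num.max 1 (psi 1 / (t * y))) => s; rewrite gt_max => /andP[s1 sy].
  have s0 : 0 < s by exact: lt_trans s1.
  rewrite damped_profile_weighted// -/psi mulNr expRN mulrC ler_pdivrMr ?expR_gt0//.
  apply: (le_trans (psid _ _ ltr01 (ltW s1))); rewrite -/psi.
  move: sy; rewrite ltr_pdivrMr ?mulr_gt0// => /ltW sy; apply: (le_trans sy).
  have e1 := expR_ge1Dx (t * s ^+ 4).
  have ts : t * s <= t * s ^+ 4.
    by rewrite ler_wpM2l ?(ltW t0)// -[leLHS]expr1 ler_weXn2l// ltW.
  rewrite (_ : s * (t * y) = y * (t * s)); last by ring.
  by rewrite ler_wpM2l ?(ltW y0)//; lra.
have FE (v : m.+3.-tuple (measurableTypeR R)) : 0 < sqn v -> Fphi (vec_of v) = (f (Num.sqrt (sqn v)))%:C.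
  move=> v0; rewrite hF ?enorm_vec_of//; apply/eqP => vE.
  have := enorm_vec_of v; rewrite vE /enorm /dotp big1 ?sqrtr0.
    by move=> /esym/eqP; rewrite sqrtr_eq0 leNgt v0.
  by move=> i _; rewrite mxE mul0r.
have ReIm (v : m.+3.-tuple (measurableTypeR R)) : 0 < sqn v ->
    exp_quartic t (vec_of v) * Fphi (vec_of v) = (G (Num.sqrt (sqn v)))%:C.
  move=> v0; rewrite FE// /exp_quartic enorm_vec_of -rmorphM /=.
  by rewrite /G damped_profileE// sqrtr_gt0.
(* Here the [L^1] hypothesis is used at the full time [t]: off the origin [G] of the radius is the
   real part of an integrable function. *)
have Gfin : (\int[lebesgue_tuple R m.+3]_v (G (Num.sqrt (sqn v)))%:E < +oo)%E.
  have [[iRe _] _] := hL1 _ t0.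
  rewrite (_ : (\int[_]_v _ = \int[lebesgue_tuple R m.+3]_v
      (complex.Re (exp_quartic t (vec_of v) * Fphi (vec_of v)))%:E)%E).
    by have := integrable_fin_num measurableT iRe; rewrite fin_numElt => /andP[].
  apply: ae_eq_integral => //.
  - by apply/measurable_EFinP; exact: measurable_radial.
  - by case/integrableP : iRe.
  - by apply: ae_eq_off_origin => v v0; rewrite ReIm.
have L1 := hL1 _ tau0.
rewrite tE (biharmonic_semigroup_integral x tau0 L1).
set c := fourier_constant R m.+3; have c0 : 0 < c by exact: fourier_constant_gt0.
pose P (v : m.+3.-tuple (measurableTypeR R)) := exp_quartic tau (vec_of v) * Fphi (vec_of v).
pose Q (v : m.+3.-tuple (measurableTypeR R)) :=
  expi (dotp x (vec_of v)) * exp_quartic tau (vec_of v).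
have [mQr mQi] := measurable_wave_packet tau x.
have [[/integrableP[/measurable_EFinP mPr _] /integrableP[/measurable_EFinP mPi _]] _] := L1.
have reE (a b : R[i]) : complex.Re (a * (c%:C * b)) =
    c * (complex.Re a * complex.Re b - complex.Im a * complex.Im b).
  by case: a b => [a1 a2] [b1 b2] /=; ring.
have imE (a b : R[i]) : complex.Im (a * (c%:C * b)) =
    c * (complex.Re a * complex.Im b + complex.Im a * complex.Re b).
  by case: a b => [a1 a2] [b1 b2] /=; ring.
(* The two half-time exponentials, one from the hypothesis and one from the wave packet, recombine
   into the one at time [t] contained in [G]. *)
have PQ v : 0 < sqn v -> P v * Q v = (G (Num.sqrt (sqn v)))%:C * expi (dotp x (vec_of v)).
  move=> v0; rewrite -ReIm// tE -exp_quarticD /P /Q; ring.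
have mtrig (k : R -> R) : continuous k -> measurable_fun setT (fun v => k (tdot (coords x) v) : R).
  move=> ck; apply: (@measurableT_comp _ _ _ _ (measurableTypeR R) _ (k : measurableTypeR R -> R)).
    exact: continuous_measurable_fun.
  exact: measurable_tdot.
have mcos := mtrig _ (@continuous_cos R); have msin := mtrig _ (@continuous_sin R).
have ReE : Rintegral (lebesgue_tuple R m.+3) setT (fun v => complex.Re (P v * (c%:C * Q v))) =
    c * Rintegral (lebesgue_tuple R m.+3) setT
      (fun v => G (Num.sqrt (sqn v)) * cos (tdot (coords x) v)).
  rewrite -Rintegral_pscale//; last by apply: measurable_funM; [exact: measurable_radial|exact: mcos].
  congr fine; apply: ae_eq_integral => //.
  - apply/measurable_EFinP; under eq_fun do rewrite reE.
    apply: measurable_funM => //.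
    by apply: measurable_funB; exact: measurable_funM.
  - apply/measurable_EFinP; apply: measurable_funM => //.
    by apply: measurable_funM; [exact: measurable_radial|exact: mcos].
  - apply: ae_eq_off_origin => v v0; rewrite reE -dotp_vec_of.
    have -> : complex.Re (P v) * complex.Re (Q v) - complex.Im (P v) * complex.Im (Q v) =
      complex.Re (P v * Q v) by case: (P v) (Q v) => [? ?] [? ?].
    by rewrite PQ//= mul0r subr0.
have ImE : Rintegral (lebesgue_tuple R m.+3) setT (fun v => complex.Im (P v * (c%:C * Q v))) =
    c * Rintegral (lebesgue_tuple R m.+3) setT
      (fun v => G (Num.sqrt (sqn v)) * sin (tdot (coords x) v)).
  rewrite -Rintegral_pscale//; last by apply: measurable_funM; [exact: measurable_radial|exact: msin].
  congr fine; apply: ae_eq_integral => //.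
  - apply/measurable_EFinP; under eq_fun do rewrite imE.
    apply: measurable_funM => //.
    by apply: measurable_funD; exact: measurable_funM.
  - apply/measurable_EFinP; apply: measurable_funM => //.
    by apply: measurable_funM; [exact: measurable_radial|exact: msin].
  - apply: ae_eq_off_origin => v v0; rewrite imE -dotp_vec_of.
    have -> : complex.Re (P v) * complex.Im (Q v) + complex.Im (P v) * complex.Re (Q v) =
      complex.Im (P v * Q v) by case: (P v) (Q v) => [? ?] [? ?].
    by rewrite PQ//= mul0r addr0.
rewrite /integralC ltcE /= ReE ImE radial_sin_integral0// mulr0 eqxx /=.
by rewrite mulr_gt0// radial_cos_integral_gt0.
Qed.
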